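(* Let $(M,F,\mathfrak{m})$ be a Finsler metric measure manifold with $\mathfrak{m}(M)=1$. Then $(M,F,\mathfrak{m})$ has normal concentration, i.e. there are positive constants $C$ and $c$ such that $\alpha_{(M,F,\mathfrak{m})}(r)\le Ce^{-cr^2}$ for every $r>0$, if and only if there are positive constants $C'$ and $c'$ such that for every 1-Lipschitz function $f$ on $(M,F,\mathfrak{m})$ and every $r>0$, $$\mathfrak{m}\left(\left\{x\in M\;\middle|\;\left|f(x)-\int_M f\,d\mathfrak{m}\right|\ge r\right\}\right)\le C'e^{-c'r^2}.$$ Here $C'=C'(C)$ and $c'=c'(c)$ are constants ($C'$ depending on $C$, and $c'$ depending on $c$).
   Context: A Finsler metric on a smooth manifold $M$ is a function $F:TM\to[0,\infty)$ that is $C^\infty$ on $TM\setminus\{0\}$, satisfies $F(x,\lambda y)=\lambda F(x,y)$ for $\lambda>0$, and for which $g_{ij}(x,y)=\frac12 (F^2)_{y^iy^j}(x,y)$ is positive definite for every nonzero $y\in T_xM$ ($F$ need not be reversible). A Finsler metric measure manifold $(M,F,\mathfrak{m})$ is a Finsler manifold $(M,F)$ with a positive smooth measure $\mathfrak{m}$. $M$ is connected, and the (possibly asymmetric) distance $d_F:M\times M\to[0,\infty)$ is $d_F(x_1,x_2)=\inf_\gamma\int_0^1F(\gamma(t),\dot\gamma(t))\,dt$ over $C^1$ curves $\gamma:[0,1]\to M$ from $x_1$ to $x_2$. For $A\subset M$, $r>0$: $B^{+}(A,r)=\{x\mid\inf_{z\in A}d_F(z,x)<r\}$ and $B^{-}(A,r)=\{x\mid\inf_{z\in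 A}d_F(x,z)<r\}$. The concentration function is $$\alpha_{(M,F,\mathfrak{m})}(r)=\sup\left\{1-\min\{\mathfrak{m}(B^{+}(A,r)),\mathfrak{m}(B^{-}(A,r))\}\;\middle|\;A\subset M\text{ Borel},\ \mathfrak{m}(A)\ge\tfrac12\right\},\quad r>0.$$ A function $f:M\to\mathbb{R}$ is 1-Lipschitz if $f(z)-f(x)\le d_F(x,z)$ for all $x,z\in M$. *)

(* Defs.v *)
From HB Require Import structures.
From mathcomp Require Export all_boot all_order all_algebra.
From mathcomp Require Export all_classical all_reals all_analysis.

Set Implicit Arguments.
Unset Strict Implicit.
Unset Printing Implicit Defensive.

Export Order.TTheory GRing.Theory Num.Theory.
Export numFieldNormedType.Exports.

Local Open Scope classical_set_scope.
Local Open Scope ring_scope.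

(* Only meant for finite-dimensional V and open U, where "all iterated
   directional derivatives exist and are continuous" is the usual C^infty. *)
Fixpoint Ck_on (R : realType) (V W : normedModType R) (k : nat)
    (U : set V) (f : V -> W) : Prop :=
  match k with
  | 0%N => forall x, U x -> {for x, continuous f}
  | k'.+1 => forall v : V,
      (forall x, U x -> derivable f x v) /\ Ck_on k' U (fun x => 'D_v f x)
  end.

Definition smooth_on (R : realType) (V W : normedModType R)
    (U : set V) (f : V -> W) : Prop :=
  forall k, Ck_on k U f.

(* The values of [chart_fun] outside [chart_dom], and of [chart_inv] outside
   the image of [chart_dom], are irrelevant. *)
Record chart (R : realType) (n : nat) (M : topologicalType) := Chart {
  chart_dom : set M ;
  chart_fun : M -> 'rV[R]_n ;
  chart_inv : 'rV[R]_n -> M ;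
  chart_dom_open : open chart_dom ;
  chart_im_open : open (chart_fun @` chart_dom) ;
  chart_funK : forall x, chart_dom x -> chart_inv (chart_fun x) = x ;
  chart_fun_continuous : {within chart_dom, continuous chart_fun} ;
  chart_inv_continuous :
    {within chart_fun @` chart_dom, continuous chart_inv} }.

Definition chart_im (R : realType) n (M : topologicalType) (e : chart R n M) :
  set 'rV[R]_n := chart_fun e @` chart_dom e.

(* [chart_at x] is a chosen chart around x. It serves only to name the tangent
   vectors at x: T_xM is identified with R^n through the differential of
   [chart_at x]. No continuity of this choice in x is assumed. *)
Record smoothManifold (R : realType) (n : nat) := SmoothManifold {
  carrier :> ptopologicalType ;
  manifold_hausdorff : hausdorff_space carrier ;
  manifold_second_countable : @second_countable carrier ;
  manifold_connected : connected [set: carrier] ;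
  atlas : set (chart R n carrier) ;
  chart_at : carrier -> chart R n carrier ;
  atlas_chart_at : forall x, atlas (chart_at x) ;
  chart_at_dom : forall x, chart_dom (chart_at x) x ;
  atlas_compatible : forall e e', atlas e -> atlas e' ->
    smooth_on (chart_fun e @` (chart_dom e `&` chart_dom e'))
              (chart_fun e' \o chart_inv e) }.

(* The element of T_xM = R^n, where x has coordinates p in the chart e, whose
   components in the chart e are w. *)
Definition tangent_of_chart (R : realType) n (M : smoothManifold R n)
    (e : chart R n M) (p w : 'rV[R]_n) : 'rV[R]_n :=
  'D_w (chart_fun (chart_at (chart_inv e p)) \o chart_inv e) p.

Definition fundamental_tensor (R : realType) n (F : 'rV[R]_n -> R)
    (y : 'rV[R]_n) : 'M[R]_n :=
  \matrix_(i, j)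
    (2^-1 * 'D_(delta_mx 0 j) (fun u => 'D_(delta_mx 0 i)
              (fun w => F w ^+ 2) u) y).

(* [finsler_smooth] reads F in the bundle chart of TM induced by e, away from
   the zero section. *)
Record finslerMetric (R : realType) n (M : smoothManifold R n) := FinslerMetric {
  finsler_fun :> M -> 'rV[R]_n -> R ;
  finsler_ge0 : forall x y, 0 <= finsler_fun x y ;
  finsler_smooth : forall e, atlas e ->
    smooth_on [set q : 'rV[R]_n * 'rV[R]_n | chart_im e q.1 /\ q.2 != 0]
      (fun q => finsler_fun (chart_inv e q.1) (tangent_of_chart e q.1 q.2)
                : R^o) ;
  finsler_homog : forall x (l : R) y, 0 < l ->
    finsler_fun x (l *: y) = l * finsler_fun x y ;
  finsler_posdef : forall x y, y != 0 -> forall v : 'rV[R]_n, v != 0 ->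
    0 < (v *m fundamental_tensor (finsler_fun x) y *m v^T) 0 0 }.

Section Curves.
Context (R : realType) (n : nat) (M : smoothManifold R n).
Implicit Types (g : R -> M) (e : chart R n M) (t : R).

(* Curves are functions on R of which only the restriction to [0, 1] matters;
   derivatives at 0 and 1 are one-sided. *)
Definition chart_quotient e g t : R -> 'rV[R]_n :=
  fun s => (s - t)^-1 *: (chart_fun e (g s) - chart_fun e (g t)).

Definition chart_velocity e g t : 'rV[R]_n :=
  lim (chart_quotient e g t s @[s --> within (`[0, 1] `\ t) (nbhs t)]).

Definition C1_curve g : Prop :=
  {within `[0, 1], continuous g} /\
  forall e, atlas e ->
    (forall t, t \in `[0, 1] -> chart_dom e (g t) ->
       cvg (chart_quotient e g t s @[s --> within (`[0, 1] `\ t) (nbhs t)])) /\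
    {within `[0, 1] `&` g @^-1` chart_dom e, continuous (chart_velocity e g)}.

Definition velocity g t : 'rV[R]_n := chart_velocity (chart_at (g t)) g t.

Definition finsler_length (F : finslerMetric M) g : \bar R :=
  \int[lebesgue_measure]_(t in `[0%R, 1%R]) (F (g t) (velocity g t))%:E.

(* The infimum is taken in the extended reals; it is finite because M is
   connected. *)
Definition finsler_dist (F : finslerMetric M) (x1 x2 : M) : \bar R :=
  ereal_inf [set finsler_length F g
            | g in [set g | [/\ C1_curve g, g 0 = x1 & g 1 = x2]]].

End Curves.

(* The Lebesgue integral over R^n of a nonnegative Borel function, as an
   iterated one-dimensional integral (Tonelli). *)
Fixpoint integral_rV (R : realType) (n : nat) : ('rV[R]_n -> \bar R) -> \bar R :=
  match n with
  | 0%N => fun f => f 0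
  | n'.+1 => fun f =>
      (\int[lebesgue_measure]_t
         integral_rV (fun v : 'rV[R]_n' => f (row_mx (t%:M : 'rV[R]_1) v)))%E
  end.

Notation borel M := (g_sigma_algebraType (@open M)).

Definition positive_smooth_measure (R : realType) n (M : smoothManifold R n)
    (m : {measure set (borel M) -> \bar R}) : Prop :=
  forall e : chart R n M, atlas e ->
    exists sigma : 'rV[R]_n -> R,
      [/\ smooth_on (chart_im e) (sigma : 'rV[R]_n -> R^o),
          forall p, chart_im e p -> 0 < sigma p &
          forall A : set (borel M), measurable A -> A `<=` chart_dom e ->
            m A = integral_rV
              (fun p => (sigma p * \1_(chart_fun e @` A) p)%:E)].

Record finslerMMM (R : realType) (n : nat) := FinslerMMM {
  fm_manifold :> smoothManifold R n ;
  fm_metric : finslerMetric fm_manifold ;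
  fm_measure : {measure set (borel fm_manifold) -> \bar R} ;
  fm_measureP : positive_smooth_measure fm_measure }.

Section Concentration.
Context (R : realType) (n : nat) (X : finslerMMM R n).
Local Notation d := (finsler_dist (fm_metric X)).
Local Notation m := (fm_measure X).
Local Open Scope ereal_scope.

Definition fball (A : set X) (r : R) : set X :=
  [set x | ereal_inf [set d z x | z in A] < r%:E].

Definition bball (A : set X) (r : R) : set X :=
  [set x | ereal_inf [set d x z | z in A] < r%:E].

Definition concentration (r : R) : \bar R :=
  ereal_sup [set 1 - Order.min (m (fball A r)) (m (bball A r))
            | A in [set A : set (borel X) |
                    measurable A /\ (2^-1)%:E <= m A]].

Definition concentration_bound (C c : R) : Prop :=
  forall r : R, (0 < r)%R -> concentration r <= (C * expR (- (c * r ^+ 2)))%:E.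

Definition normal_concentration : Prop :=
  exists C c : R, [/\ (0 < C)%R, (0 < c)%R & concentration_bound C c].

Definition lipschitz1 (f : X -> R) : Prop :=
  forall x z, (f z - f x)%:E <= d x z.

(* The mean is an extended real. If it is not finite, or undefined (then the
   library gives it the value -oo), the deviation set is all of X, so the bound
   over all r > 0 contains the integrability of f when X has mass 1. *)
Definition lipschitz_deviation_bound (C c : R) : Prop :=
  forall f : X -> R, lipschitz1 f -> forall r : R, (0 < r)%R ->
    m [set x | r%:E <= `|(f x)%:E - \int[m]_y (f y)%:E|]
      <= (C * expR (- (c * r ^+ 2)))%:E.

End Concentration.

(* Main.v *)
(* The distance d satisfies the triangle inequality (concatenation of C^1 curves
   after a reparametrization that stops at the junction) and d(x, y), d(y, x)
   tend to 0 as y tends to x (straight segments in a chart); hence 1-Lipschitz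
   functions are continuous and the enlargements B^+ and B^- are open, so that
   all sets involved are Borel.
   Deviation => concentration: if m(A) >= 1/2, the 1-Lipschitz functions
   min(d(A, .), r) and - min(d(., A), r) vanish on A and their means are at
   most r/2 in absolute value, so the complements of B^+(A, r) and B^-(A, r)
   lie in a set where the deviation from the mean is at least r/2.
   Concentration => deviation: for a median M of f, apply the hypothesis to
   B^+({f <= M}, r) and B^-({f >= M}, r) to get a Gaussian tail for |f - M|;
   integrating it bounds |E f - M| by a constant of order 1/sqrt(c), and
   M can be replaced by E f at the cost of constants. *)

From HB Require Import structures.
Require Import Defs.
From mathcomp Require Import ring lra measurable_realfun.
Set Implicit Arguments.
Unset Strict Implicit.
Unset Printing Implicit Defensive.

Local Open Scope classical_set_scope.
Local Open Scope ring_scope.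

(** * Strict differentiability of C^1 maps *)

Section Calculus.
Context (R : realType).

Lemma mx_norm_leP (m n : nat) (A : 'M[R]_(m, n)) (e : R) : 0 <= e ->
  (`|A| <= e) <-> (forall i j, `|A i j| <= e).
Proof.
move=> e0; rewrite [`|A|]/Num.norm/= mx_normrE; split.
  move=> h i j; apply: le_trans h.
  by apply: (le_bigmax _ (fun ij => `|A ij.1 ij.2|) (i, j)).
by move=> h; apply: bigmax_le => // -[i j] _; exact: h.
Qed.

(** The scalar mean value theorem is applied to each entry, with its own intermediate point; since
    matrices carry the max norm, the entrywise bounds give the bound on the norm. *)
Lemma mean_value_ineq (m n : nat) (g dg : R -> 'M[R]_(m, n)) (l : 'M[R]_(m, n)) (e : R) :
  (forall t : R, 0 <= t <= 1 -> is_derive t 1 g (dg t)) ->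
  (forall t : R, 0 <= t <= 1 -> `|dg t - l| <= e) ->
  `|g 1 - g 0 - l| <= e.
Proof.
move=> gdg dgl.
have e0 : 0 <= e.
  have := dgl 0; rewrite lexx ler01 => /(_ isT); apply: le_trans; exact: normr_ge0.
apply/mx_norm_leP => // i j.
have gij (t : R) : 0 <= t <= 1 -> is_derive t 1 (fun s => g s i j) (dg t i j).
  move=> t01; have [gd gE] := gdg t t01.
  apply: DeriveDef; first exact: (derivable_mxP _ _ _).1.
  by rewrite -gE derive_mx// mxE.
have [||c cI] := @MVT _ (fun s => g s i j) (fun s => dg s i j) 0 1 ltr01.
- by move=> t; rewrite in_itv/= => /andP[t0 t1]; apply: gij; rewrite !ltW.
- apply: derivable_within_continuous => t; rewrite in_itv/= => t01.
  by have [] := gij t t01.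
rewrite subr0 mulr1 !mxE => ->.
have := (mx_norm_leP (dg c - l) e0).1 (dgl c _) i j; rewrite !mxE; apply.
by move: cI; rewrite in_itv/= => /andP[? ?]; rewrite !ltW.
Qed.

Lemma is_derive_scale (V W : normedModType R) (f : V -> W) (x v : V) (l : W) (a : R) :
  is_derive x v f l -> is_derive x (a *: v) f (a *: l).
Proof.
move=> [fd fE]; have [->|a0] := eqVneq a 0.
  by rewrite !scale0r; exact: is_derive0.
suff h : (fun h => h^-1 *: ((f \o shift x) (h *: (a *: v)) - f x)) @ 0^' --> a *: l.
  by apply: DeriveDef; [apply/cvg_ex; eexists; exact: h|exact/cvg_lim].
(* The quotient along [a v] at step [h] is [a] times the quotient along [v] at step [h a], and [h a]
   stays nonzero since [a] is. *)
have -> : (fun h => h^-1 *: ((f \o shift x) (h *: (a *: v)) - f x)) =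
    (fun h => a *: ((h * a)^-1 *: ((f \o shift x) ((h * a) *: v) - f x))).
  by apply/funext => h; rewrite !scalerA invfM mulrCA mulfV// mulr1.
rewrite -fE; apply: cvgZl_tmp.
have ha : (fun h : R => h * a) @ 0^' --> 0^'.
  move=> A [e /= e0 eA]; exists (e / `|a|) => /=; first by rewrite divr_gt0// normr_gt0.
  move=> h /=; rewrite sub0r normrN => he h0; apply: eA; last by rewrite mulf_neq0.
  by rewrite /= sub0r normrN normrM -ltr_pdivlMr ?normr_gt0.
exact: (cvg_comp _ _ ha fd).
Qed.

Lemma line_is_derive (V W : normedModType R) (f : V -> W) (q v : V) (t : R) :
  derivable f (q + t *: v) v -> is_derive t 1 (fun s => f (q + s *: v)) ('D_v f (q + t *: v)).
Proof.
move=> fd.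
have E : (fun h => h^-1 *: (((fun s => f (q + s *: v)) \o shift t) (h *: (1 : R^o)) - f (q + t *: v)))
   = (fun h => h^-1 *: ((f \o shift (q + t *: v)) (h *: v) - f (q + t *: v))).
  by apply/funext => h /=; rewrite -[h *: 1]/(h * 1) mulr1 scalerDl addrCA.
by apply: DeriveDef; rewrite /derivable /derive E.
Qed.
End Calculus.

Section StrictIncrement.
Context (R : realType).

Lemma norm_coord_le (m n : nat) (A : 'M[R]_(m, n)) i j : `|A i j| <= `|A|.
Proof. exact: (mx_norm_leP A (normr_ge0 A)).1. Qed.

Lemma norm_delta_mx_le1 (m n : nat) (i : 'I_m) (j : 'I_n) :
  `|delta_mx i j : 'M[R]_(m, n)| <= 1.
Proof.
apply/mx_norm_leP => // k l; rewrite mxE.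
by case: (_ && _); rewrite ?normr1 ?normr0.
Qed.

Context (m n : nat) (U : set 'rV[R]_n) (f : 'rV[R]_n -> 'rV[R]_m).
Hypotheses (oU : open U) (fC1 : Ck_on 1 U f).

(** The differential of [f] at [p] written with partial derivatives. It is linear in [h] by
    construction, which ['D_h f p] is not; [C1_deriveE] identifies the two for C^1 maps. *)
Definition linearization (p h : 'rV[R]_n) : 'rV[R]_m :=
  \sum_i h 0 i *: 'D_(delta_mx 0 i) f p.

(* Telescoping over the coordinates reduces this to the mean value inequality
   along one basis vector at a time; the base point q is left free so that the
   induction goes through. *)
Lemma C1_strict_increment (p : 'rV[R]_n) (s : seq 'I_n) (e : R) : U p -> 0 < e ->
  exists2 d, 0 < d & forall q h : 'rV[R]_n, `|q - p| < d -> `|h| < d ->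
    `|f (q + \sum_(i <- s) h 0 i *: delta_mx 0 i) - f q
      - \sum_(i <- s) h 0 i *: 'D_(delta_mx 0 i) f p| <= e * (size s)%:R * `|h|.
Proof.
move=> Up e0; elim: s => [|i s [d d0 IH]].
  by exists 1 => // q h _ _; rewrite !big_nil addr0 !subrr normr0 mulr0 mul0r.
have [fd fc] := fC1 (delta_mx 0 i).
have : \forall x \near p, U x /\ `|'D_(delta_mx 0 i) f p - 'D_(delta_mx 0 i) f x| < e.
  apply: filterI; first exact: open_nbhs_nbhs.
  by have /cvgrPdist_lt := fc p Up; apply.
move=> /nbhs_ballP[r /= r0 rP].
pose D := Num.min d r.
have D0 : 0 < D by rewrite lt_min d0.
(* One half is for [q - p] and one for [h]: the segment from [q] to [q + a ei] then stays within [D]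
   of [p], where both the continuity estimate and the induction hypothesis hold. *)
exists (D / 2); first by rewrite divr_gt0.
move=> q h qp hD; rewrite !big_cons.
set ei := delta_mx 0 i; set a := h 0 i.
have ah : `|a| <= `|h| by exact: norm_coord_le.
have near_p (t : R) : 0 <= t <= 1 -> `|q + t *: (a *: ei) - p| < D.
  move=> /andP[t0 t1]; rewrite addrAC (le_lt_trans (ler_normD _ _))//.
  rewrite [ltRHS]splitr ltrD// !normrZ (le_lt_trans _ hD)//.
  rewrite (ger0_norm t0) mulrA.
  apply: le_trans (_ : `|a| * `|ei| <= _).
    by rewrite ler_wpM2r// ler_piMl.
  by rewrite (le_trans _ ah)// ler_piMr// norm_delta_mx_le1.
have h1 : `|f (q + a *: ei) - f q - a *: 'D_ei f p| <= e * `|h|.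
  have := @mean_value_ineq R _ _ (fun t => f (q + t *: (a *: ei)))
    (fun t => a *: 'D_ei f (q + t *: (a *: ei))) (a *: 'D_ei f p) (e * `|h|).
  rewrite scale1r scale0r addr0; apply => t t01.
    have /rP[Ux _] : ball p r (q + t *: (a *: ei)).
      rewrite -ball_normE /= distrC (lt_le_trans (near_p t t01))//.
      by rewrite ge_min lexx orbT.
    have fi := is_derive_scale a (derivableP (fd _ Ux)).
    have fE := @derive_val _ _ _ _ _ _ _ fi.
    by rewrite -fE; apply: line_is_derive; exact: ex_derive.
  have /rP[_ /ltW Dx] : ball p r (q + t *: (a *: ei)).
    rewrite -ball_normE /= distrC (lt_le_trans (near_p t t01))//.
    by rewrite ge_min lexx orbT.
  rewrite -scalerBr normrZ [X in _ * X]distrC [leRHS]mulrC; exact: ler_pM.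
have h2 : `|f (q + a *: ei + \sum_(j <- s) h 0 j *: delta_mx 0 j) - f (q + a *: ei)
   - \sum_(j <- s) h 0 j *: 'D_(delta_mx 0 j) f p| <= e * (size s)%:R * `|h|.
  apply: IH.
    have := near_p 1; rewrite scale1r lexx ler01 => /(_ isT) /lt_le_trans; apply.
    by rewrite ge_min lexx.
  by have : D <= d; [rewrite ge_min lexx | lra].
rewrite [leRHS](_ : _ = e * (size s)%:R * `|h| + e * `|h|); last first.
  by rewrite /= -natr1; ring.
apply: le_trans (lerD h2 h1); apply: le_trans (ler_normD _ _).
rewrite le_eqVlt; apply/orP; left; apply/eqP; congr (`|_|).
by apply/matrixP => k l; rewrite addrA !mxE; ring.
Qed.

End StrictIncrement.

(** * The chain rule along an arbitrary filter *)

Section Chain.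
Context (R : realType) (m n : nat).
Variables (U : set 'rV[R]_n) (f : 'rV[R]_n -> 'rV[R]_m).
Hypotheses (oU : open U) (fC1 : Ck_on 1 U f).

Lemma linearizationZ (p h : 'rV[R]_n) (a : R) :
  linearization f p (a *: h) = a *: linearization f p h.
Proof.
rewrite /linearization scaler_sumr; apply: eq_bigr => i _.
by rewrite mxE scalerA.
Qed.

Lemma linearization_cvg (T : Type) (F : set_system T) {FF : Filter F}
    (p w : 'rV[R]_n) (h : T -> 'rV[R]_n) :
  h @ F --> w -> linearization f p (h x) @[x --> F] --> linearization f p w.
Proof.
move=> hw; rewrite /linearization; apply: cvg_big => [|i _]; first exact: add_continuous.
apply: cvgZr_tmp; exact: (cvg_comp _ _ hw (@coord_continuous R 1 n 0 i w)).
Qed.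

(** The strict increment estimate bounds the error by a small multiple of [|h|], and [|h| / |a|]
    stays below [|w| + 1]. The filter is arbitrary so that the same statement serves directional
    derivatives, one-sided curve velocities under a change of chart, and coordinate segments. *)
Lemma C1_quotient_linearization (T : Type) (F : set_system T) {FF : Filter F}
    (p w : 'rV[R]_n) (a : T -> R) (h : T -> 'rV[R]_n) : U p ->
  h @ F --> (0 : 'rV[R]_n) ->
  (a x)^-1 *: h x @[x --> F] --> w ->
  (a x)^-1 *: (f (p + h x) - f p) @[x --> F] --> linearization f p w.
Proof.
move=> Up h0 hw; apply/cvgrPdist_le => e e0.
(* With increment accuracy [e / 2 / K] the final error is at most [e / 2]; the added 1 keeps [K]
   positive when [n] is 0. *)
pose K : R := n%:R * (`|w| + 1) + 1.
have K0 : 0 < K by rewrite ltr_wpDl// mulr_ge0// addr_ge0.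
have e'0 : 0 < e / 2 / K by rewrite !divr_gt0.
have [d d0 dP] := C1_strict_increment oU fC1 (enum 'I_n) Up e'0.
have hd : \forall x \near F, `|h x| < d.
  move/cvgrPdist_lt: h0 => /(_ _ d0); apply: filterS => x.
  by rewrite sub0r normrN.
have hw1 : \forall x \near F, `|(a x)^-1 *: h x| <= `|w| + 1.
  move/cvgrPdist_le: hw => /(_ _ ltr01); apply: filterS => x hx.
  rewrite -[X in `|X|](subKr w) (le_trans (ler_normB _ _))// lerD2l//.
have Lw : \forall x \near F, `|linearization f p w - linearization f p ((a x)^-1 *: h x)| <= e / 2.
  have e2 : 0 < e / 2 by rewrite divr_gt0.
  by have /cvgrPdist_le := @linearization_cvg _ F FF p _ _ hw; apply.
apply: filterS (filterI hd (filterI hw1 Lw)) => x [xd [x1 xL]].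
rewrite [X in _ <= X]splitr.
have := dP p (h x); rewrite subrr normr0 => /(_ d0 xd).
rewrite size_enum_ord !big_enum/= -[\sum_i _ *: 'D_ _ f p]/(linearization f p (h x)).
have -> : \sum_i h x 0 i *: delta_mx 0 i = h x by rewrite [RHS]row_sum_delta.
move=> H; rewrite -(subrKA (linearization f p ((a x)^-1 *: h x))).
apply: le_trans (ler_normD _ _) _; apply: lerD => //.
rewrite linearizationZ -scalerBr normrZ distrC.
apply: le_trans (ler_wpM2l (normr_ge0 _) H) _.
rewrite mulrCA -normrZ.
apply: le_trans (_ : e / 2 / K * n%:R * (`|w| + 1) <= _).
  by rewrite ler_wpM2l// mulr_ge0// ltW.
have e20 : 0 <= e / 2 by rewrite divr_ge0// ltW.
rewrite -(mulrA _ n%:R) -(mulrA _ K^-1); apply: ler_piMr => //.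
rewrite ler_pdivrMl// mulr1 /K; lra.
Qed.

(** The filter statement for increments [h w] as [h] tends to 0: divided by [h], they are constantly
    [w]. *)
Lemma C1_deriveE (p w : 'rV[R]_n) : U p -> 'D_w f p = linearization f p w.
Proof.
move=> Up; apply/cvg_lim => //.
have := @C1_quotient_linearization _ (0 : R)^' _ p w id (fun h => h *: w) Up.
have -> : (fun h => h^-1 *: ((f \o shift p) (h *: w) - f p)) =
  (fun h => h^-1 *: (f (p + h *: w) - f p)).
  by apply/funext => h /=; rewrite (addrC (h *: w)).
apply.
  rewrite -[X in _ --> X](scale0r w); apply: cvgZr_tmp.
  by apply: cvg_within_filter; exact: cvg_id.
apply: cvg_near_cst.
rewrite near_withinE; near=> h => h0 /=.
by rewrite scalerA mulVf// scale1r.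
Unshelve. all: by end_near. Qed.

End Chain.

(** * The Finsler norm in a chart *)

Section Charts.
Context (R : realType) (n : nat) (M : smoothManifold R n).
Implicit Types (e : chart R n M).

Lemma chart_fun_cts e x : chart_dom e x -> {for x, continuous (chart_fun e)}.
Proof.
move=> ex; have := @chart_fun_continuous _ _ _ e.
rewrite (continuous_open_subspace _ (@chart_dom_open _ _ _ e)).
by apply; exact: mem_set.
Qed.

Lemma chart_inv_cts e p : chart_im e p -> {for p, continuous (chart_inv e)}.
Proof.
move=> ep; have := @chart_inv_continuous _ _ _ e.
rewrite (continuous_open_subspace _ (@chart_im_open _ _ _ e)).
by apply; exact: mem_set.
Qed.

Lemma chart_im_fun e x : chart_dom e x -> chart_im e (chart_fun e x).
Proof. by exists x. Qed.

Lemma chart_inv_dom e p : chart_im e p -> chart_dom e (chart_inv e p).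
Proof. by move=> [x ex <-]; rewrite chart_funK. Qed.

Lemma chart_invK e p : chart_im e p -> chart_fun e (chart_inv e p) = p.
Proof. by move=> [x ex <-]; rewrite chart_funK. Qed.

Definition overlap e e' := chart_fun e @` (chart_dom e `&` chart_dom e').

Lemma overlapP e e' p :
  overlap e e' p <-> chart_im e p /\ chart_dom e' (chart_inv e p).
Proof.
split; first by move=> [x [ex e'x] <-]; rewrite chart_funK//; split => //; exists x.
move=> [ep e'p]; exists (chart_inv e p); last exact: chart_invK.
by split => //; exact: chart_inv_dom.
Qed.

Lemma near_chart_im e p : chart_im e p -> \forall q \near p, chart_im e q.
Proof. by move=> ep; apply: open_nbhs_nbhs; split => //; exact: chart_im_open. Qed.

Lemma open_overlap e e' : open (overlap e e').
Proof.
rewrite openE => p /overlapP[ep e'p].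
have h : \forall q \near p, chart_dom e' (chart_inv e q).
  apply: (chart_inv_cts ep); apply: open_nbhs_nbhs; split => //.
  exact: chart_dom_open.
by apply: filterS (filterI (near_chart_im ep) h) => q ?; apply/overlapP.
Qed.

Definition transition e e' := chart_fun e' \o chart_inv e.

Lemma transition_C1 e e' : atlas e -> atlas e' ->
  Ck_on 1 (overlap e e') (transition e e').
Proof. by move=> ae ae'; exact: atlas_compatible. Qed.

Lemma tangent_of_chartE e p w : tangent_of_chart e p w =
  'D_w (transition e (chart_at (chart_inv e p))) p.
Proof. by []. Qed.

Lemma overlap_chart_at e p : chart_im e p ->
  overlap e (chart_at (chart_inv e p)) p.
Proof. by move=> ep; apply/overlapP; split => //; exact: chart_at_dom. Qed.

Lemma tangent_of_chartZ e p a w : atlas e -> chart_im e p ->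
  tangent_of_chart e p (a *: w) = a *: tangent_of_chart e p w.
Proof.
move=> ae ep.
have tC1 := transition_C1 ae (atlas_chart_at (chart_inv e p)).
rewrite !tangent_of_chartE !(C1_deriveE (@open_overlap _ _) tC1) ?linearizationZ//;
  exact: overlap_chart_at.
Qed.

Variable F : finslerMetric M.

(** Homogeneity with factor 2 gives F(0) = 2 F(0). *)
Lemma finsler0 x : F x 0 = 0.
Proof.
have := @finsler_homog _ _ _ F x 2 0 (ltr0Sn _ 1); rewrite scaler0; lra.
Qed.

Lemma finslerZ x (a : R) y : 0 <= a -> F x (a *: y) = a * F x y.
Proof.
rewrite le_eqVlt => /predU1P[<-|a0]; first by rewrite scale0r mul0r finsler0.
exact: finsler_homog.
Qed.

(** The Finsler function in the bundle chart induced by [e]. Because [chart_at] may jump, continuity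
    in the base point makes sense only in such a fixed chart. *)
Definition chart_norm e (p w : 'rV[R]_n) : R :=
  F (chart_inv e p) (tangent_of_chart e p w).

Lemma chart_normZ e p (a : R) w : atlas e -> chart_im e p -> 0 <= a ->
  chart_norm e p (a *: w) = a * chart_norm e p w.
Proof. by move=> ae ep a0; rewrite /chart_norm tangent_of_chartZ// finslerZ. Qed.

Lemma chart_norm0 e p : atlas e -> chart_im e p -> chart_norm e p 0 = 0.
Proof. by move=> ae ep; rewrite -(scale0r 0) chart_normZ// mul0r. Qed.

Lemma chart_norm_continuous_neq0 e p w : atlas e -> chart_im e p -> w != 0 ->
  {for (p, w), continuous (fun q : 'rV[R]_n * 'rV[R]_n => chart_norm e q.1 q.2)}.
Proof.
move=> ae ep w0; have := finsler_smooth F ae 0%N; apply; split => //.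
Qed.

Lemma compact_sphere : compact [set w : 'rV[R]_n | `|w| = 1].
Proof.
apply: bounded_closed_compact.
  exists 1; split; first exact: num_real.
  by move=> r r1 w /= ->; exact: ltW.
have -> : [set w : 'rV[R]_n | `|w| = 1] = (fun w : 'rV[R]_n => `|w|) @^-1` [set 1] by [].
apply: closed_comp => [w _|]; first exact: norm_continuous.
exact: closed_eq.
Qed.

(** Continuity and compactness of the unit sphere bound the norm of unit vectors uniformly near [p];
    homogeneity extends the bound to all vectors. *)
Lemma chart_norm_bound e p : atlas e -> chart_im e p ->
  exists2 L : R, 0 < L & \forall q \near p, forall w, chart_norm e q w <= L * `|w|.
Proof.
move=> ae ep.
have /compact_near_coveringP := compact_sphere.
(* The compactness argument runs along the product of [L] tending to infinity and [q] tending to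
   [p], so it yields the constant and the neighbourhood together. *)
move=> /(_ _ (filter_prod (+oo%R : set_system R) (nbhs p))
  (fun Lq w => chart_norm e Lq.2 w <= Lq.1)).
case.
  move=> w w1.
  have w0 : w != 0 by rewrite -normr_eq0 w1 oner_eq0.
  pose c := chart_norm e p w.
  have /cvgrPdist_lt /(_ 1 ltr01) := chart_norm_continuous_neq0 ae ep w0.
  move=> [[A B] /= [Ap Bw] AB].
  exists (B, [set L | c + 1 <= L] `*` A).
    split => //=; exists ([set L | c + 1 <= L], A) => //; split => //=.
    by apply: nbhs_pinfty_ge; exact: num_real.
  move=> [w' [L q]] /= [Bw' [cL Aq]].
  have /= := AB (q, w') (conj Aq Bw'); rewrite -/c ltr_norml => /andP[h _].
  lra.
move=> [A B] /= [Aoo Bp] AB.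
have [L [AL L0]] : exists L, A L /\ 0 < L.
  by apply: (@filter_ex _ (+oo%R : set_system R)); apply: filterI => //; apply: nbhs_pinfty_gt; exact: num_real.
exists L => //; apply: filterS (filterI Bp (near_chart_im ep)) => q [Bq eq] w.
have [->|w0] := eqVneq w 0; first by rewrite chart_norm0// normr0 mulr0.
have nw : `|w| != 0 by rewrite normr_eq0.
rewrite -{1}(scalerKV nw w) chart_normZ// mulrC ler_wpM2r//.
apply: (AB (L, q)) => //=.
by rewrite normrZ normfV normr_id mulVf.
Qed.

Lemma chart_norm_ge0 e p w : 0 <= chart_norm e p w.
Proof. exact: finsler_ge0. Qed.

(** Smoothness covers only nonzero vectors; at the zero vector continuity follows from the local
    bound by [L |w|]. *)
Lemma chart_norm_continuous e p w : atlas e -> chart_im e p ->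
  {for (p, w), continuous (fun q : 'rV[R]_n * 'rV[R]_n => chart_norm e q.1 q.2)}.
Proof.
move=> ae ep; have [->|w0] := eqVneq w 0; last exact: chart_norm_continuous_neq0.
have [L L0 NL] := chart_norm_bound ae ep.
apply/cvgrPdist_lt => eps e0 /=.
exists ([set q | forall w, chart_norm e q w <= L * `|w|],
        [set v : 'rV[R]_n | `|v| < eps / L]) => /=.
  split => //; apply/nbhs_ballP; exists (eps / L) => /=; first exact: divr_gt0.
  by move=> v; rewrite -ball_normE /= sub0r normrN.
move=> [q v] /= [qL vL]; rewrite chart_norm0// sub0r normrN ger0_norm ?chart_norm_ge0//.
by rewrite (le_lt_trans (qL v))// mulrC -ltr_pdivlMr.
Qed.

End Charts.

(** * Speed and length of C^1 curves *)

Lemma cvg_near_eq (T : Type) (V : topologicalType) (F : set_system T)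
    {FF : Filter F} (f g : T -> V) (l : V) :
  f @ F --> l -> (\forall x \near F, f x = g x) -> g @ F --> l.
Proof. by move=> fl fg; apply: cvg_trans fl; apply: near_eq_cvg. Qed.

Section Curves.
Context (R : realType) (n : nat) (M : smoothManifold R n).
Implicit Types (e : chart R n M) (g : R -> M) (t s : R).

(** Properness makes limits unique, so the [lim] in [chart_velocity] can be computed. A step of
    length at most 1/2, to the right when t < 1/2 and to the left otherwise, stays in the unit
    interval. *)
Lemma itv01_dnbhs_proper (t : R) : t \in `[0, 1] ->
  ProperFilter (within (`[0, 1] `\ t) (nbhs t)).
Proof.
rewrite in_itv/= => /andP[t0 t1]; split; last exact: within_filter.
move=> /nbhs_ballP[r /= r0 rP].
pose d := Num.min (r / 2) (1 / 2).
have d0 : 0 < d by rewrite lt_min !divr_gt0.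
have dr : d <= r / 2 by rewrite ge_min lexx.
have d1 : d <= 1 / 2 by rewrite ge_min lexx orbT.
have [t2|t2] := ltP t (1 / 2).
  apply: (rP (t + d)).
    by rewrite -ball_normE /= opprD addNKr normrN gtr0_norm//; lra.
  by split; [rewrite /= in_itv/=; lra|move=> /= /eqP; rewrite -subr_eq0 addrC addKr gt_eqF].
apply: (rP (t - d)).
  by rewrite -ball_normE /= opprB addrCA subrr addr0 gtr0_norm//; lra.
split; [rewrite /= in_itv/=; lra|move=> /= /eqP].
by rewrite -subr_eq0 addrAC subrr sub0r oppr_eq0 gt_eqF.
Qed.

Lemma chart_velocityE e g t (w : 'rV[R]_n) : t \in `[0, 1] ->
  chart_quotient e g t s @[s --> within (`[0, 1] `\ t) (nbhs t)] --> w ->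
  chart_velocity e g t = w.
Proof.
move=> t01 gw; have PF := itv01_dnbhs_proper t01.
exact/cvg_lim.
Qed.

Lemma cvg_quotient e g t : C1_curve g -> atlas e -> t \in `[0, 1] ->
  chart_dom e (g t) ->
  chart_quotient e g t s @[s --> within (`[0, 1] `\ t) (nbhs t)] -->
    chart_velocity e g t.
Proof. by move=> [_ gC] ae t01 gt; have [/(_ t t01 gt)] := gC e ae. Qed.

Lemma C1_curve_cvg g t : C1_curve g -> t \in `[0, 1] ->
  g @ within `[0, 1] (nbhs t) --> g t.
Proof. by move=> [/subspace_continuousP + _]; apply. Qed.

Lemma C1_curve_near g t (U : set M) : C1_curve g -> t \in `[0, 1] ->
  open U -> U (g t) -> \forall s \near within `[0, 1] (nbhs t), U (g s).
Proof.
by move=> gC t01 oU Ugt; apply: (C1_curve_cvg gC t01); apply: open_nbhs_nbhs.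
Qed.

Lemma cvg_chart_velocity e g t : C1_curve g -> atlas e -> t \in `[0, 1] ->
  chart_dom e (g t) ->
  chart_velocity e g @ within `[0, 1] (nbhs t) --> chart_velocity e g t.
Proof.
move=> gC ae t01 gt; have [_ /(_ e ae)[_ /subspace_continuousP]] := gC.
move=> /(_ t (conj t01 gt)) h A /h wA.
have {}wA : nbhs t [set s | (`[0, 1] `&` g @^-1` chart_dom e) s ->
    A (chart_velocity e g s)] := wA.
have nd : nbhs t [set s | `[0, 1]%classic s -> chart_dom e (g s)] :=
  C1_curve_near gC t01 (@chart_dom_open _ _ _ e) gt.
suff : nbhs t [set s | `[0, 1]%classic s -> A (chart_velocity e g s)] by [].
by apply: filterS (filterI wA nd) => s [sA sd] s01; apply: sA; split => //; exact: sd.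
Qed.

Lemma within_punctured (A : set R) (t : R) :
  within (A `\ t) (nbhs t) `=>` within A (nbhs t).
Proof.
move=> P PA; have {}PA : nbhs t [set s | A s -> P s] := PA.
suff : nbhs t [set s | (A `\ t) s -> P s] by [].
by apply: filterS PA => s PA [As _]; exact: PA.
Qed.

(** Velocities transform by the differential of the transition map: this is the chain rule along the
    punctured neighbourhoods of [t] in the unit interval. *)
Lemma velocity_chart e g t : C1_curve g -> atlas e -> t \in `[0, 1] ->
  chart_dom e (g t) ->
  velocity g t = tangent_of_chart e (chart_fun e (g t)) (chart_velocity e g t).
Proof.
move=> gC ae t01 gt; rewrite /velocity tangent_of_chartE chart_funK//.
set e' := chart_at (g t).
have ae' : atlas e' by exact: atlas_chart_at.
have oe := @open_overlap _ _ _ e e'.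
have eC1 := transition_C1 ae ae'.
have ept : overlap e e' (chart_fun e (g t)).
  by exists (g t) => //; split => //; exact: chart_at_dom.
apply: chart_velocityE => //.
rewrite (C1_deriveE oe eC1)//.
have FF : Filter (within (`[0, 1] `\ t) (nbhs t)) by exact: within_filter.
have ct : (fun s => chart_fun e (g s)) @ within `[0, 1] (nbhs t) --> chart_fun e (g t).
  exact: (cvg_comp _ _ (C1_curve_cvg gC t01) (chart_fun_cts gt)).
have h0 : (fun s => chart_fun e (g s) - chart_fun e (g t)) @
    within (`[0, 1] `\ t) (nbhs t) --> (0 : 'rV[R]_n).
  rewrite -(subrr (chart_fun e (g t))); apply: cvgB; last exact: cvg_cst.
  by apply: cvg_trans ct; apply: cvg_app; exact: within_punctured.
have cq := C1_quotient_linearization (FF := FF) oe eC1 ept h0 (cvg_quotient gC ae t01 gt).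
apply: cvg_near_eq cq _.
have near_dom : \forall s \near within (`[0, 1] `\ t) (nbhs t), chart_dom e (g s).
  exact: (within_punctured (C1_curve_near gC t01 (@chart_dom_open _ _ _ e) gt)).
apply: filterS near_dom => s gs.
by rewrite /chart_quotient /transition /= addrCA subrr addr0 !chart_funK.
Qed.

Variable F : finslerMetric M.

Definition speed g t : R := F (g t) (velocity g t).

Lemma speed_chart e g t : C1_curve g -> atlas e -> t \in `[0, 1] ->
  chart_dom e (g t) ->
  speed g t = chart_norm F e (chart_fun e (g t)) (chart_velocity e g t).
Proof.
by move=> gC ae t01 gt; rewrite /speed (velocity_chart gC ae)// /chart_norm chart_funK.
Qed.

(** The chart used by [velocity] changes with the point, so near each [t] the speed is first
    rewritten in the single chart chosen at [g t]. *)
Lemma speed_continuous g : C1_curve g -> {within `[0, 1], continuous (speed g)}.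
Proof.
move=> gC; apply/subspace_continuousP => t t01.
suff : speed g @ within `[0, 1] (nbhs t) --> speed g t by [].
have {}t01 : t \in `[0, 1] by [].
set e := chart_at (g t).
have ae : atlas e by exact: atlas_chart_at.
have gt : chart_dom e (g t) by exact: chart_at_dom.
rewrite (speed_chart gC ae t01 gt).
have FF : Filter (within `[0, 1] (nbhs t)) by exact: within_filter.
have ct : (fun s => chart_fun e (g s)) @ within `[0, 1] (nbhs t) --> chart_fun e (g t).
  exact: (cvg_comp _ _ (C1_curve_cvg gC t01) (chart_fun_cts gt)).
have vt := cvg_chart_velocity gC ae t01 gt.
have cp : (fun s => (chart_fun e (g s), chart_velocity e g s)) @ within `[0, 1] (nbhs t)
    --> (chart_fun e (g t), chart_velocity e g t).
  exact: cvg_pair ct vt.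
have cv : (fun s => chart_norm F e (chart_fun e (g s)) (chart_velocity e g s))
    @ within `[0, 1] (nbhs t) --> chart_norm F e (chart_fun e (g t)) (chart_velocity e g t).
  apply: (@cvg_comp _ _ _ _ (fun q => chart_norm F e q.1 q.2) _ _ _ cp).
  exact: (@chart_norm_continuous _ _ _ F e _ (chart_velocity e g t) ae (chart_im_fun gt)).
apply: cvg_near_eq cv _.
have gs := C1_curve_near gC t01 (@chart_dom_open _ _ _ e) gt.
have s01 : \forall s \near within `[0, 1] (nbhs t), s \in `[0, 1].
  by suff : nbhs t [set s | `[0, 1]%classic s -> s \in `[0, 1]] by []; apply: filterE => s sI; exact: sI.
apply: filterS (filterI gs s01) => s [gs' s01'] /=.
by rewrite (speed_chart gC ae).
Qed.

End Curves.

(** * Coordinate segments and smallness of the distance near a point *)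

Section Segments.
Context (R : realType) (n : nat) (M : smoothManifold R n) (F : finslerMetric M).
Implicit Types (e : chart R n M) (g : R -> M) (t s : R).

(** A criterion with an explicit candidate [vel] in every chart: uniqueness of limits identifies it
    with [chart_velocity]. *)
Lemma C1_curve_of_velocity g (vel : chart R n M -> R -> 'rV[R]_n) :
  (forall t, t \in `[0, 1] -> g @ within `[0, 1] (nbhs t) --> g t) ->
  (forall e t, atlas e -> t \in `[0, 1] -> chart_dom e (g t) ->
     chart_quotient e g t s @[s --> within (`[0, 1] `\ t) (nbhs t)] --> vel e t) ->
  (forall e t, atlas e -> t \in `[0, 1] -> chart_dom e (g t) ->
     vel e @ within (`[0, 1] `&` g @^-1` chart_dom e) (nbhs t) --> vel e t) ->
  C1_curve g.
Proof.
move=> gc gv vc; split; first exact/subspace_continuousP.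
move=> e ae; split; first by move=> t t01 gt; apply/cvg_ex; exists (vel e t); exact: gv.
apply/subspace_continuousP => t [t01 gt].
have E s : s \in `[0, 1] -> chart_dom e (g s) -> chart_velocity e g s = vel e s.
  by move=> s01 gs; apply: chart_velocityE => //; exact: gv.
suff : chart_velocity e g @ within (`[0, 1] `&` g @^-1` chart_dom e) (nbhs t)
    --> chart_velocity e g t by [].
rewrite E//; have FF : Filter (within (`[0, 1] `&` g @^-1` chart_dom e) (nbhs t)).
  exact: within_filter.
apply: cvg_near_eq (vc e t ae t01 gt) _.
suff : nbhs t [set s | (`[0, 1] `&` g @^-1` chart_dom e) s ->
  vel e s = chart_velocity e g s] by [].
by apply: filterE => s [s01 gs]; rewrite E.
Qed.

Lemma finsler_length_le g (K : R) : C1_curve g ->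
  (forall t, t \in `[0, 1] -> speed F g t <= K) -> (finsler_length F g <= K%:E)%E.
Proof.
move=> gC gK.
have K0 : 0 <= K.
  by apply: le_trans (finsler_ge0 F (g 0) (velocity g 0)) (gK 0 _); rewrite in_itv/= lexx ler01.
apply: (@le_trans _ _ (\int[lebesgue_measure]_(t in `[0%R, 1%R]) (cst K%:E t))%E).
  apply: ge0_le_integral => //.
  - by move=> t _; rewrite lee_fin finsler_ge0.
  - apply/measurable_EFinP; apply: subspace_continuous_measurable_fun => //.
    exact: speed_continuous.
rewrite integral_cst//= lebesgue_measure_itv/= lte_fin ltr01 oppr0 adde0 mule1//.
Qed.

Section segment.
Variables (e : chart R n M) (p v : 'rV[R]_n).
Hypothesis ae : atlas e.
Hypothesis seg : forall t, t \in `[0, 1] -> chart_im e (p + t *: v).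

Definition segment t : M := chart_inv e (p + t *: v).

Lemma line_continuous t : (fun s => p + s *: v) @ nbhs t --> p + t *: v.
Proof. by apply: cvgD; [exact: cvg_cst|apply: cvgZr_tmp; exact: cvg_id]. Qed.

Lemma segment_overlap e' t : t \in `[0, 1] -> chart_dom e' (segment t) ->
  overlap e e' (p + t *: v).
Proof. by move=> t01 e't; apply/overlapP; split => //; exact: seg. Qed.

Lemma segment_cvg t : t \in `[0, 1] -> segment @ nbhs t --> segment t.
Proof.
move=> t01; apply: (cvg_comp _ _ (@line_continuous t)).
exact: (chart_inv_cts (seg t01)).
Qed.

Lemma segment_quotient e' t : atlas e' -> t \in `[0, 1] -> chart_dom e' (segment t) ->
  chart_quotient e' segment t s @[s --> within (`[0, 1] `\ t) (nbhs t)] -->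
  'D_v (transition e e') (p + t *: v).
Proof.
move=> ae' t01 e't; have oe := @open_overlap _ _ _ e e'.
have eC1 := transition_C1 ae ae'.
have pt := segment_overlap t01 e't.
rewrite (C1_deriveE oe eC1)//.
have FF : Filter (within (`[0, 1] `\ t) (nbhs t)) by exact: within_filter.
have h0 : (fun s => (s - t) *: v) @ within (`[0, 1] `\ t) (nbhs t) --> (0 : 'rV[R]_n).
  rewrite -[X in _ --> X](scale0r v); apply: cvgZr_tmp.
  rewrite -(subrr t); apply: cvgB; last exact: cvg_cst.
  by apply: cvg_within_filter; exact: cvg_id.
have hv : (s - t)^-1 *: ((s - t) *: v) @[s --> within (`[0, 1] `\ t) (nbhs t)] --> v.
  apply: cvg_near_cst.
  suff : nbhs t [set s | (`[0, 1] `\ t) s -> (s - t)^-1 *: ((s - t) *: v) = v] by [].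
  apply: filterE => s [_ /= /eqP st].
  by rewrite scalerA mulVf ?scale1r// subr_eq0.
apply: cvg_near_eq (C1_quotient_linearization (FF := FF) oe eC1 pt h0 hv) _.
apply: filterE => s.
have -> : p + t *: v + (s - t) *: v = p + s *: v by rewrite -addrA -scalerDl subrKC.
by [].
Qed.

Lemma segment_velocity_cvg e' t : atlas e' -> t \in `[0, 1] -> chart_dom e' (segment t) ->
  (fun s => 'D_v (transition e e') (p + s *: v)) @ nbhs t -->
  'D_v (transition e e') (p + t *: v).
Proof.
move=> ae' t01 e't.
apply: (@cvg_comp _ _ _ _ (fun q => 'D_v (transition e e') q) _ _ _ (@line_continuous t)).
have [_ h] := transition_C1 ae ae' v.
exact: (h _ (segment_overlap t01 e't)).
Qed.

Lemma segment_C1 : C1_curve segment.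
Proof.
apply: (C1_curve_of_velocity (vel := fun e' s => 'D_v (transition e e') (p + s *: v))).
- by move=> t t01; apply: cvg_within_filter; exact: segment_cvg.
- by move=> e' t ae' t01 e't; exact: segment_quotient.
- by move=> e' t ae' t01 e't; apply: cvg_within_filter; exact: segment_velocity_cvg.
Qed.

Lemma segment_speed t : t \in `[0, 1] ->
  speed F segment t = chart_norm F e (p + t *: v) v.
Proof.
move=> t01; rewrite /speed /chart_norm -/(segment t); congr (F _ _).
apply: chart_velocityE => //; apply: segment_quotient => //; first exact: atlas_chart_at.
exact: chart_at_dom.
Qed.

End segment.

(** The coordinate segment from [p] to [q] is a competitor whose speed never exceeds [L |q - p|]. *)
Lemma finsler_dist_chart_le e (p q : 'rV[R]_n) (L : R) : atlas e ->
  (forall t, t \in `[0, 1] -> chart_im e (p + t *: (q - p))) ->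
  (forall t w, t \in `[0, 1] -> chart_norm F e (p + t *: (q - p)) w <= L * `|w|) ->
  (finsler_dist F (chart_inv e p) (chart_inv e q) <= (L * `|q - p|)%:E)%E.
Proof.
move=> ae seg NL; apply: ge_ereal_inf; exists (finsler_length F (segment e p (q - p))).
  exists (segment e p (q - p)) => //; split; first exact: segment_C1.
  - by rewrite /segment scale0r addr0.
  - by rewrite /segment scale1r subrKC.
apply: finsler_length_le; first exact: segment_C1.
by move=> t t01; rewrite segment_speed//; exact: NL.
Qed.

Lemma finsler_dist_ge0 x y : (0 <= finsler_dist F x y)%E.
Proof.
apply: le_ereal_inf_tmp => _ [g _ <-]; apply: integral_ge0 => t _.
by rewrite lee_fin finsler_ge0.
Qed.

Lemma finsler_dist_refl x : finsler_dist F x x = 0%E.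
Proof.
apply/eqP; rewrite eq_le finsler_dist_ge0 andbT.
have ae := atlas_chart_at x; set e := chart_at x in ae.
have ex : chart_dom e x by exact: chart_at_dom.
have [L L0 /nbhs_singleton NL] := chart_norm_bound F ae (chart_im_fun ex).
have := @finsler_dist_chart_le e (chart_fun e x) (chart_fun e x) L ae.
rewrite chart_funK// subrr normr0 mulr0; apply => t.
  by rewrite scaler0 addr0 => _; exact: chart_im_fun.
by move=> w _; rewrite scaler0 addr0.
Qed.

(** In a chart ball around [x] on which the norm is at most [L |w|], segments in either direction
    have length at most [L] times the coordinate distance. Both directions are recorded because [F]
    may be irreversible. *)
Lemma finsler_dist_near x (eps : R) : 0 < eps -> \forall x' \near x,
  (finsler_dist F x x' < eps%:E)%E /\ (finsler_dist F x' x < eps%:E)%E.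
Proof.
move=> eps0.
have ae := atlas_chart_at x; set e := chart_at x in ae.
have ex : chart_dom e x by exact: chart_at_dom.
set p := chart_fun e x.
have [L L0 NL] := chart_norm_bound F ae (chart_im_fun ex).
have [r /= r0 rP] := (nbhs_ballP _ _).1 (filterI NL (near_chart_im (chart_im_fun ex))).
have d0 : 0 < Num.min r (eps / L) by rewrite lt_min r0 divr_gt0.
have near_q : \forall x' \near x, `|p - chart_fun e x'| < Num.min r (eps / L).
  by have /cvgrPdist_lt := chart_fun_cts ex; apply.
have near_dom : \forall x' \near x, chart_dom e x'.
  by apply: open_nbhs_nbhs; split => //; exact: chart_dom_open.
apply: filterS (filterI near_q near_dom) => x' [].
rewrite lt_min => /andP[qr qe] ex'.
set q := chart_fun e x' in qr qe.
(* Balls are convex, so a segment between two points of the ball stays where the norm bound is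
   valid. *)
have conv (a b : 'rV[R]_n) : `|p - a| < r -> `|p - b| < r ->
    forall t, t \in `[0, 1] -> ball p r (a + t *: (b - a)).
  move=> pa pb t; rewrite in_itv/= => /andP[t0 t1]; rewrite -ball_normE/=.
  have -> : p - (a + t *: (b - a)) = (1 - t) *: (p - a) + t *: (p - b).
    by apply/matrixP => i j; rewrite !mxE; ring.
  apply: le_lt_trans (ler_normD _ _) _; rewrite !normrZ.
  rewrite !ger0_norm ?subr_ge0//.
  have m0 : Num.max `|p - a| `|p - b| < r by rewrite gt_max pa pb.
  apply: le_lt_trans m0.
  have := @le_max _ _ `|p - a| `|p - a| `|p - b|; rewrite lexx/= => ma.
  have := @le_max _ _ `|p - b| `|p - a| `|p - b|; rewrite lexx orbT => mb.
  set mm := Num.max _ _ in ma mb *.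
  move: ma mb; set u := `|p - a|; set w := `|p - b| => ma mb; nra.
have dist_lt (a b : 'rV[R]_n) : `|p - a| < r -> `|p - b| < r -> `|b - a| < eps / L ->
    (finsler_dist F (chart_inv e a) (chart_inv e b) < eps%:E)%E.
  move=> pa pb ab; apply: le_lt_trans (finsler_dist_chart_le (L := L) ae _ _) _.
  - by move=> t t01; have [] := rP _ (conv a b pa pb t t01).
  - by move=> t w t01; have [+ _] := rP _ (conv a b pa pb t t01); apply.
  - by rewrite lte_fin mulrC -ltr_pdivlMr.
rewrite -(chart_funK ex) -(chart_funK ex') -/p -/q.
have pp : `|p - p| < r by rewrite subrr normr0.
by split; apply: dist_lt => //; rewrite distrC.
Qed.

End Segments.

(** * Concatenation and the triangle inequality *)

Section Reparametrization.
Context (R : realType) (n : nat) (M : smoothManifold R n) (F : finslerMetric M).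
Implicit Types (e : chart R n M) (g : R -> M) (t s : R).

Lemma is_derive_quotient (phi : R -> R) t (l : R) : is_derive t 1 phi l ->
  (s - t)^-1 * (phi s - phi t) @[s --> t^'] --> l.
Proof.
move=> [pd <-].
have st : (fun s => s - t) @ t^' --> 0^'.
  move=> A [r /= r0 rA]; exists r => //= s /= st sneq; apply: rA.
    by rewrite /= sub0r normrN distrC.
  by rewrite subr_eq0.
have := cvg_comp _ _ st pd.
have -> // : ((fun h => h^-1 *: ((phi \o shift t) (h *: (1 : R)) - phi t)) \o (fun s => s - t)) =
  (fun s => (s - t)^-1 * (phi s - phi t)).
by apply/funext => s /=; rewrite -[_ *: 1]/(_ * 1) mulr1 subrK.
Qed.

Variables (g : R -> M) (a b : R) (phi dphi : R -> R).
Hypotheses (gC : C1_curve g) (ab : a < b).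
Hypothesis phiE : forall t, is_derive t 1 phi (dphi t).
Hypothesis dphi_cont : continuous dphi.
Hypothesis phi_incr : {in `[a, b] &, {homo phi : x y / x < y}}.
Hypotheses (phia : phi a = 0) (phib : phi b = 1).

Lemma reparam_itv t : t \in `[a, b] -> phi t \in `[0, 1].
Proof.
move=> tab; have le := ltW_homo_in phi_incr.
move: (tab); rewrite !in_itv/= => /andP[at' tb].
by rewrite -phia -phib !le// in_itv/= ?lexx ?(ltW ab).
Qed.

Lemma reparam_continuous : continuous phi.
Proof.
by move=> t; apply: differentiable_continuous; apply/derivable1_diffP; have [] := phiE t.
Qed.

Lemma reparam_within t : phi @ within `[a, b] (nbhs t) --> within `[0, 1] (nbhs (phi t)).
Proof.
move=> A A1; have {}A1 : nbhs (phi t) [set s | `[0, 1]%classic s -> A s] := A1.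
suff : nbhs t [set s | `[a, b]%classic s -> A (phi s)] by [].
have B1 : nbhs t [set s | `[0, 1]%classic (phi s) -> A (phi s)] := reparam_continuous A1.
apply: filterS B1 => s sA sab; apply: sA.
exact: reparam_itv.
Qed.

(** Strict monotonicity keeps [phi s] away from [phi t], so difference quotients of [g] may be
    composed with [phi]. *)
Lemma reparam_punctured t : t \in `[a, b] ->
  phi @ within (`[a, b] `\ t) (nbhs t) --> within (`[0, 1] `\ phi t) (nbhs (phi t)).
Proof.
move=> tab A A1.
have {}A1 : nbhs (phi t) [set s | (`[0, 1] `\ phi t) s -> A s] := A1.
suff : nbhs t [set s | (`[a, b] `\ t) s -> A (phi s)] by [].
have B1 : nbhs t [set s | (`[0, 1] `\ phi t) (phi s) -> A (phi s)] := reparam_continuous A1.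
apply: filterS B1 => s sA [sab st]; apply: sA; split.
  exact: reparam_itv.
by move=> /= /(inc_inj_in (le_mono_in phi_incr)) E; apply: st; apply: E.
Qed.

Lemma reparam_cvg t : t \in `[a, b] ->
  (g \o phi) @ within `[a, b] (nbhs t) --> g (phi t).
Proof.
move=> tab; apply: (cvg_comp _ _ (@reparam_within t)).
by apply: C1_curve_cvg => //; exact: reparam_itv.
Qed.

(** The quotient of [g \o phi] factors as the quotient of [phi] times the quotient of [g] at
    [phi s]. *)
Lemma reparam_quotient e t : atlas e -> t \in `[a, b] -> chart_dom e (g (phi t)) ->
  chart_quotient e (g \o phi) t s @[s --> within (`[a, b] `\ t) (nbhs t)] -->
    dphi t *: chart_velocity e g (phi t).
Proof.
move=> ae tab gt.
have FF : Filter (within (`[a, b] `\ t) (nbhs t)) by exact: within_filter.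
have q1 : (s - t)^-1 * (phi s - phi t) @[s --> within (`[a, b] `\ t) (nbhs t)] --> dphi t.
  apply: cvg_trans (is_derive_quotient (phiE t)); apply: cvg_app.
  move=> A A1; have {}A1 : nbhs t [set s | s != t -> A s] := A1.
  suff : nbhs t [set s | (`[a, b] `\ t) s -> A s] by [].
  by apply: filterS A1 => s sA [_ /eqP]; exact: sA.
have q2 := cvg_comp _ _ (reparam_punctured tab) (cvg_quotient gC ae (reparam_itv tab) gt).
have q3 := cvgZ (FF := FF) q1 q2.
apply: cvg_near_eq q3 _.
suff : nbhs t [set s | (`[a, b] `\ t) s ->
  (s - t)^-1 * (phi s - phi t) *: (chart_quotient e g (phi t) \o phi) s =
   chart_quotient e (g \o phi) t s] by [].
apply: filterE => s [sab st]; rewrite /chart_quotient /= scalerA -mulrA mulfV ?mulr1//.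
rewrite subr_eq0; apply/eqP => /(inc_inj_in (le_mono_in phi_incr)) E; apply: st; exact: E.
Qed.

Lemma reparam_velocity_cvg e t : atlas e -> t \in `[a, b] -> chart_dom e (g (phi t)) ->
  dphi s *: chart_velocity e g (phi s) @[s --> within `[a, b] (nbhs t)] -->
    dphi t *: chart_velocity e g (phi t).
Proof.
move=> ae tab gt; apply: cvgZ.
  by apply: cvg_within_filter; exact: dphi_cont.
apply: (cvg_comp _ _ (@reparam_within t)).
by apply: cvg_chart_velocity => //; exact: reparam_itv.
Qed.

Lemma reparam_length :
  (\int[lebesgue_measure]_(t in `[a, b]) (speed F g (phi t) * dphi t)%:E = finsler_length F g)%E.
Proof.
rewrite /finsler_length -[in RHS]phia -[in RHS]phib.
have dE : (phi^`())%classic = dphi.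
  by apply/funext => t; rewrite derive1E; have [_ ->] := phiE t.
rewrite (@integration_by_substitution_increasing _ phi (speed F g) a b)//.
- by rewrite dE.
- exact: ltW.
- by rewrite dE => t _; exact: dphi_cont.
- by rewrite dE; apply/cvg_ex; exists (dphi a); apply: cvg_at_right_filter; exact: dphi_cont.
- by rewrite dE; apply/cvg_ex; exists (dphi b); apply: cvg_at_left_filter; exact: dphi_cont.
- split.
  + by move=> t _; have [] := phiE t.
  + by apply: cvg_at_right_filter; exact: reparam_continuous.
  + by apply: cvg_at_left_filter; exact: reparam_continuous.
- by rewrite phia phib; exact: speed_continuous.
Qed.

End Reparametrization.

(** * Concatenation of two curves through slowed time changes *)

Section Concatenation.
Context (R : realType) (n : nat) (M : smoothManifold R n) (F : finslerMetric M).
Implicit Types (e : chart R n M) (g : R -> M) (t s : R).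

Local Notation J1 := (`[(0 : R), 2^-1]).
Local Notation J2 := (`[(2^-1 : R), 1]).
Local Notation J3 := (`](2^-1 : R), 1]).

(** Each closed half either contains [t], and its convergence hypothesis applies, or misses a
    neighbourhood of [t]. The junction, where both halves contain [t], thus needs no separate
    treatment. *)
Lemma cvg_within_glue (V : topologicalType) (D1 D2 D : set R) (f f1 f2 : R -> V)
    t (l : V) :
  (forall s, D s -> s \in J1 -> D1 s) -> (forall s, D s -> s \in J2 -> D2 s) ->
  (forall s, D s -> s \in `[0, 1]) ->
  {in J1, f =1 f1} -> {in J2, f =1 f2} ->
  (t \in J1 -> f1 @ within D1 (nbhs t) --> l) ->
  (t \in J2 -> f2 @ within D2 (nbhs t) --> l) ->
  f @ within D (nbhs t) --> l.
Proof.
move=> DD1 DD2 D01 ff1 ff2 c1 c2 A lA.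
have far (a b : R) : t \notin `[a, b] -> nbhs t [set s | s \notin `[a, b]].
  move=> tab; have : open (~` [set` `[a, b]]) by rewrite openC; exact: itv_closed.
  rewrite openE => /(_ t) h; have : nbhs t (~` [set` `[a, b]]).
    by apply: h => /=; apply/negP.
  by apply: filterS => s /= /negP.
have h1 : nbhs t [set s | D s -> s \in J1 -> A (f s)].
  have [tJ|tJ] := boolP (t \in J1).
    have h : nbhs t [set s | D1 s -> A (f1 s)] := c1 tJ A lA.
    by apply: filterS h => s sA Ds sJ; rewrite ff1//; apply: sA; exact: DD1.
  by apply: filterS (far _ _ tJ) => s /= /negP sJ _ /sJ.
have h2 : nbhs t [set s | D s -> s \in J2 -> A (f s)].
  have [tJ|tJ] := boolP (t \in J2).
    have h : nbhs t [set s | D2 s -> A (f2 s)] := c2 tJ A lA.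
    by apply: filterS h => s sA Ds sJ; rewrite ff2//; apply: sA; exact: DD2.
  by apply: filterS (far _ _ tJ) => s /= /negP sJ _ /sJ.
suff : nbhs t [set s | D s -> A (f s)] by [].
apply: filterS (filterI h1 h2) => s [s1 s2] Ds.
have := D01 _ Ds; rewrite in_itv/= => /andP[s0 s1'].
have [sh|/ltW sh] := leP s 2^-1; first by apply: s1 => //; rewrite in_itv/= s0.
by apply: s2 => //; rewrite in_itv/= sh.
Qed.

(* Both time changes have zero derivative at 1/2, which makes the concatenation
   C^1 at the junction whatever the end velocities of g1 and g2. *)
Definition time1 t : R := 4 * t - 4 * t ^+ 2.
Definition dtime1 t : R := 4 - 8 * t.
Definition time2 t : R := 4 * t ^+ 2 - 4 * t + 1.
Definition dtime2 t : R := 8 * t - 4.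

Lemma time1E t : is_derive t 1 time1 (dtime1 t).
Proof.
rewrite /time1; apply: is_derive_eq; rewrite /dtime1 /= -![_ *: _]/(_ * _); ring.
Qed.

Lemma time2E t : is_derive t 1 time2 (dtime2 t).
Proof.
rewrite /time2; apply: is_derive_eq; rewrite /dtime2 /= -![_ *: _]/(_ * _); ring.
Qed.

Lemma affine_continuous (a b : R) : continuous (fun t : R => a * t + b).
Proof. by move=> t; apply: cvgD; [apply: cvgM; [exact: cvg_cst|exact: cvg_id]|exact: cvg_cst]. Qed.

Lemma dtime1_continuous : continuous dtime1.
Proof.
rewrite (_ : dtime1 = fun t => - 8 * t + 4); first exact: affine_continuous.
by apply/funext => t; rewrite /dtime1; ring.
Qed.

Lemma dtime2_continuous : continuous dtime2.
Proof.
rewrite (_ : dtime2 = fun t => 8 * t + (- 4)); first exact: affine_continuous.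
by apply/funext => t; rewrite /dtime2; ring.
Qed.

Lemma time1_incr : {in J1 &, {homo time1 : x y / x < y}}.
Proof.
move=> x y; rewrite !in_itv/= => /andP[x0 x1] /andP[y0 y1] xy; rewrite /time1.
nra.
Qed.

Lemma time2_incr : {in J2 &, {homo time2 : x y / x < y}}.
Proof.
move=> x y; rewrite !in_itv/= => /andP[x0 x1] /andP[y0 y1] xy; rewrite /time2.
nra.
Qed.

Lemma time1_0 : time1 0 = 0. Proof. by rewrite /time1; ring. Qed.
Lemma time1_h : time1 2^-1 = 1. Proof. by rewrite /time1; field. Qed.
Lemma time2_h : time2 2^-1 = 0. Proof. by rewrite /time2; field. Qed.
Lemma time2_1 : time2 1 = 1. Proof. by rewrite /time2; ring. Qed.
Lemma dtime1_h : dtime1 2^-1 = 0. Proof. by rewrite /dtime1; field. Qed.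
Lemma dtime2_h : dtime2 2^-1 = 0. Proof. by rewrite /dtime2; field. Qed.

Variables g1 g2 : R -> M.
Hypotheses (g1C : C1_curve g1) (g2C : C1_curve g2) (g12 : g1 1 = g2 0).

Definition concat t : M := if t <= 2^-1 then g1 (time1 t) else g2 (time2 t).

Definition concat_velocity e t : 'rV[R]_n :=
  if t <= 2^-1 then dtime1 t *: chart_velocity e g1 (time1 t)
  else dtime2 t *: chart_velocity e g2 (time2 t).

Lemma concat1 : {in J1, concat =1 g1 \o time1}.
Proof. by move=> t; rewrite in_itv/= /concat => /andP[_ ->]. Qed.

Lemma concat2 : {in J2, concat =1 g2 \o time2}.
Proof.
move=> t; rewrite in_itv/= /concat le_eqVlt => /andP[/predU1P[<-|ht] _] /=.
  by rewrite lexx time1_h time2_h.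
by rewrite leNgt ht.
Qed.

Lemma concat_velocity1 e : {in J1, concat_velocity e =1
  fun t => dtime1 t *: chart_velocity e g1 (time1 t)}.
Proof. by move=> t; rewrite in_itv/= /concat_velocity => /andP[_ ->]. Qed.

(** At 1/2 the definition takes the first branch; the two formulas agree there because both time
    changes have derivative 0. *)
Lemma concat_velocity2 e : {in J2, concat_velocity e =1
  fun t => dtime2 t *: chart_velocity e g2 (time2 t)}.
Proof.
move=> t; rewrite in_itv/= /concat_velocity le_eqVlt => /andP[/predU1P[<-|ht] _] /=.
  by rewrite lexx dtime1_h dtime2_h !scale0r.
by rewrite leNgt ht.
Qed.

Let h0 : (0 : R) < 2^-1. Proof. by rewrite invr_gt0. Qed.
Let h1 : (2^-1 : R) < 1. Proof. by rewrite invf_lt1// ltr1n. Qed.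

Lemma concat_quotient e t : atlas e -> t \in `[0, 1] -> chart_dom e (concat t) ->
  chart_quotient e concat t s @[s --> within (`[0, 1] `\ t) (nbhs t)] -->
    concat_velocity e t.
Proof.
move=> ae t01 ct.
have notself (J : interval R) : forall s, ([set` `[0, 1]] `\ t) s -> s \in J ->
    ([set` J] `\ t) s by move=> s [_ st].
(* The quotient also involves the base point [concat t], which may be replaced by the value on one
   half only if [t] lies in that half; otherwise the quotient of [concat] itself is kept. *)
pose K1 := fun s => if t \in J1 then chart_quotient e (g1 \o time1) t s else chart_quotient e concat t s.
pose K2 := fun s => if t \in J2 then chart_quotient e (g2 \o time2) t s else chart_quotient e concat t s.
apply: (cvg_within_glue (D1 := [set` J1] `\ t) (D2 := [set` J2] `\ t) (f1 := K1) (f2 := K2)).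
- exact: notself.
- exact: notself.
- by move=> s [].
- move=> s sJ; rewrite /K1; case: ifPn => // tJ1.
  by rewrite /chart_quotient !concat1.
- move=> s sJ; rewrite /K2; case: ifPn => // tJ1.
  by rewrite /chart_quotient !concat2.
- move=> tJ1; rewrite /K1 tJ1 concat_velocity1//.
  have ct1 : chart_dom e (g1 (time1 t)) by rewrite -[g1 _]/((g1 \o time1) t) -concat1.
  exact: (reparam_quotient g1C h0 time1E time1_incr time1_0 time1_h ae tJ1 ct1).
- move=> tJ2; rewrite /K2 tJ2 concat_velocity2//.
  have ct2 : chart_dom e (g2 (time2 t)) by rewrite -[g2 _]/((g2 \o time2) t) -concat2.
  exact: (reparam_quotient g2C h1 time2E time2_incr time2_h time2_1 ae tJ2 ct2).
Qed.

Lemma concat_C1 : C1_curve concat.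
Proof.
apply: (C1_curve_of_velocity (vel := concat_velocity)).
- move=> t t01.
  apply: (cvg_within_glue (D1 := [set` J1]) (D2 := [set` J2])) concat1 concat2 _ _ => //.
  + move=> tJ; rewrite concat1//.
    exact: (reparam_cvg g1C h0 time1E time1_incr time1_0 time1_h tJ).
  + move=> tJ; rewrite concat2//.
    exact: (reparam_cvg g2C h1 time2E time2_incr time2_h time2_1 tJ).
- by move=> e t ae t01 ct; exact: concat_quotient.
move=> e t ae t01 ct.
apply: (cvg_within_glue (D1 := [set` J1]) (D2 := [set` J2])) (@concat_velocity1 e)
  (@concat_velocity2 e) _ _ => //.
+ by move=> s [].
+ move=> tJ; rewrite concat_velocity1//.
  have ct1 : chart_dom e (g1 (time1 t)) by rewrite -[g1 _]/((g1 \o time1) t) -concat1.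
  exact: (reparam_velocity_cvg g1C h0 time1E dtime1_continuous time1_incr time1_0 time1_h ae tJ ct1).
+ move=> tJ; rewrite concat_velocity2//.
  have ct2 : chart_dom e (g2 (time2 t)) by rewrite -[g2 _]/((g2 \o time2) t) -concat2.
  exact: (reparam_velocity_cvg g2C h1 time2E dtime2_continuous time2_incr time2_h time2_1 ae tJ ct2).
Qed.

Lemma concat_speed t : t \in `[0, 1] ->
  speed F concat t = F (concat t) (concat_velocity (chart_at (concat t)) t).
Proof.
move=> t01; rewrite /speed; congr (F _ _); apply: chart_velocityE => //.
by apply: concat_quotient => //; [exact: atlas_chart_at|exact: chart_at_dom].
Qed.

(** Positive homogeneity of [F] applies because [dtime1] is nonnegative on the first half. *)
Lemma concat_speed1 t : t \in J1 -> speed F concat t = speed F g1 (time1 t) * dtime1 t.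
Proof.
move=> tJ; have := tJ; rewrite in_itv/= => /andP[t0 th].
rewrite concat_speed ?in_itv/= ?t0 ?(le_trans th (ltW h1))//.
rewrite concat_velocity1// concat1// mulrC finslerZ//.
rewrite /dtime1; lra.
Qed.

Lemma concat_speed2 t : t \in J2 -> speed F concat t = speed F g2 (time2 t) * dtime2 t.
Proof.
move=> tJ; have := tJ; rewrite in_itv/= => /andP[th t1].
rewrite concat_speed ?in_itv/= ?t1 ?(le_trans (ltW h0) th)//.
rewrite concat_velocity2// concat2// mulrC finslerZ//.
rewrite /dtime2; lra.
Qed.

Lemma concat_length :
  (finsler_length F concat = finsler_length F g1 + finsler_length F g2)%E.
Proof.
have mS : measurable_fun (`[0, 1]%classic : set R) (fun t => (speed F concat t)%:E).
  apply/measurable_EFinP; apply: subspace_continuous_measurable_fun => //.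
  exact: speed_continuous concat_C1.
have s0 t : (0 <= (speed F concat t)%:E)%E by rewrite lee_fin finsler_ge0.
have E : [set` `[(0 : R), 1]] = [set` J1] `|` [set` J3].
  apply/seteqP; split => t /=; rewrite !in_itv/=.
    move=> /andP[t0 t1]; have [th|th] := leP t 2^-1; first by left; rewrite t0.
    by right; rewrite t1.
  by move=> [/andP[? ?]|/andP[? ?]]; lra.
have D : [disjoint [set` J1] & [set` J3]].
  apply/disj_setPS => t /= []; rewrite !in_itv/= => /andP[_ th] /andP[ht _].
  by move: ht; rewrite ltNge th.
have mU : measurable_fun ([set` J1] `|` [set` J3]) (fun t => (speed F concat t)%:E).
  by rewrite -E.
transitivity (\int[lebesgue_measure]_(t in [set` J1] `|` [set` J3])
  (speed F concat t)%:E)%E; first by rewrite -E.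
apply: etrans (@ge0_integral_setU _ _ R lebesgue_measure _ _ (measurable_itv _)
  (measurable_itv _) _ mU (fun t _ => s0 t) D) _.
(* The split is half-open for disjointness; the endpoint 1/2, being Lebesgue-null, is now put
   back. *)
rewrite integral_itv_obnd_cbnd; last first.
  by apply: measurable_funS mS => // t tJ; have : ([set` J1] `|` [set` J3]) t by [right]; rewrite -E.
apply: f_equal2.
  rewrite -(reparam_length F g1C h0 time1E dtime1_continuous time1_incr time1_0 time1_h).
  by apply: eq_integral => t /set_mem/= tJ; rewrite -concat_speed1.
rewrite -(reparam_length F g2C h1 time2E dtime2_continuous time2_incr time2_h time2_1).
by apply: eq_integral => t /set_mem/= tJ; rewrite -concat_speed2.
Qed.

Lemma concat_0 : concat 0 = g1 0.
Proof. by rewrite /concat ltW// time1_0. Qed.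

Lemma concat_1 : concat 1 = g2 1.
Proof. by rewrite /concat leNgt h1/= time2_1. Qed.

End Concatenation.

(** When a distance on the right is infinite the bound is trivial; otherwise two curves within
    [eps / 2] of the infima are concatenated. *)
Lemma finsler_dist_triangle (R : realType) n (M : smoothManifold R n)
    (F : finslerMetric M) (x y z : M) :
  (finsler_dist F x z <= finsler_dist F x y + finsler_dist F y z)%E.
Proof.
have [xy|] := boolP (finsler_dist F x y \is a fin_num); last first.
  rewrite ge0_fin_numE ?finsler_dist_ge0// -leNgt leye_eq => /eqP ->.
  by rewrite addye ?leey// gt_eqF// (lt_le_trans _ (finsler_dist_ge0 F y z)).
have [yz|] := boolP (finsler_dist F y z \is a fin_num); last first.
  rewrite ge0_fin_numE ?finsler_dist_ge0// -leNgt leye_eq => /eqP ->.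
  by rewrite addey ?leey// gt_eqF// (lt_le_trans _ (finsler_dist_ge0 F x y)).
apply/lee_addgt0Pr => eps eps0.
have e2 : 0 < eps / 2 by rewrite divr_gt0.
have [_ [g1 [g1C g10 g11] <-] l1] := lb_ereal_inf_adherent e2 xy.
have [_ [g2 [g2C g20 g21] <-] l2] := lb_ereal_inf_adherent e2 yz.
have g12 : g1 1 = g2 0 by rewrite g11 g20.
apply: le_trans (_ : finsler_length F (concat g1 g2) <= _)%E.
  apply: ereal_inf_lbound; exists (concat g1 g2) => //; split.
  - exact: concat_C1.
  - by rewrite concat_0.
  - by rewrite concat_1.
rewrite concat_length//; apply: le_trans (leeD (ltW l1) (ltW l2)) _.
by rewrite addeACA -EFinD -splitr.
Qed.

(** * Medians and subgaussian tails *)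

Section Probability.
Context d (T : measurableType d) (R : realType) (P : probability T R).
Implicit Types f g : {RV P >-> R}.

Lemma measurable_RV_le f (t : R) : measurable [set x | f x <= t].
Proof.
rewrite -[X in measurable X]setTI.
rewrite (_ : [set x | _] = f @^-1` `]-oo, t]); first exact: measurable_funP.
by apply/seteqP; split => x /=; rewrite in_itv.
Qed.

Lemma measurable_RV_ge f (t : R) : measurable [set x | t <= f x].
Proof.
rewrite -[X in measurable X]setTI.
rewrite (_ : [set x | _] = f @^-1` `[t, +oo[); first exact: measurable_funP.
by apply/seteqP; split => x /=; rewrite in_itv/= andbT.
Qed.

Lemma measurable_RV_dist f (t : R) : measurable_fun setT (fun x => `|f x - t|).
Proof. by apply: measurableT_comp => //; exact: measurable_funB. Qed.

Definition RV_dist f (t : R) : {RV P >-> R} := HB.pack (fun x => `|f x - t|)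
  (isMeasurableFun.Build _ _ _ _ _ (measurable_RV_dist f t)).

Lemma cdf_setE f (t : R) : cdf f t = P [set x | f x <= t].
Proof.
by rewrite /cdf /distribution/= /pushforward; congr (P _). Qed.

(** The median is the infimum of the [t] whose cdf is at least 1/2; the limits of the cdf at the two
    infinities make this set nonempty and bounded below. Right continuity gives the lower half. *)
Lemma median_exists f : exists M : R,
  ((2^-1)%:E <= P [set x | (f x <= M)%R])%E /\
  ((2^-1)%:E <= P [set x | (M <= f x)%R])%E.
Proof.
pose S := [set t : R | ((2^-1)%:E <= cdf f t)%E].
have h01 : 0 < 2^-1 :> R by rewrite invr_gt0.
have h1 : 2^-1 < 1 :> R by rewrite invf_lt1// ltr1n.
have S0 : S !=set0.
  apply/set0P/eqP => S0.
  suff : (1 <= (2^-1 : R)%:E)%E by rewrite lee_fin leNgt h1.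
  apply: cvge_le (cvg_cdfy1 f); apply: filterE => t.
  by apply/ltW; rewrite ltNge; apply/negP => St; rewrite -[False]/(set0 t) -S0.
have lS : has_lbound S.
  apply: contrapT => nlS.
  suff : ((2^-1 : R)%:E <= 0)%E by rewrite lee_fin leNgt h01.
  apply: cvge_ge (cvg_cdfNy0 f); apply: filterE => t.
  apply: contrapT => /negP; rewrite -ltNge => ft; apply: nlS.
  exists t => s Ss; rewrite leNgt; apply/negP => st.
  by move: ft; rewrite ltNge (le_trans Ss)// cdf_nondecreasing// ltW.
exists (inf S); split.
  rewrite -cdf_setE.
  have cr : cdf f x @[x --> (inf S)^'+] --> cdf f (inf S).
    exact: cdf_right_continuous.
  apply: cvge_ge cr; near=> t.
  have : inf S < t by near: t; exact: nbhs_right_gt.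
  move=> /(inf_lt S0)[s Ss st].
  by rewrite (le_trans Ss)// cdf_nondecreasing// ltW.
(* For the upper half, the event f < [inf S] is the increasing union of these sets, each of
   probability below 1/2 because its threshold lies outside [S]. *)
pose F n := [set x | f x <= inf S - n.+1%:R^-1].
have FE : \bigcup_n F n = ~` [set x | inf S <= f x].
  apply/seteqP; split => x /=.
    move=> [n _ /= fx]; apply/negP; rewrite -ltNge (le_lt_trans fx)//.
    by rewrite ltrBlDr ltrDl invr_gt0.
  move=> /negP; rewrite -ltNge => /ltr_add_invr[n nfx].
  by exists n => //=; rewrite /F/= lerBrDr ltW.
have Fle n : (P (F n) <= (2^-1)%:E)%E.
  apply/ltW; rewrite -cdf_setE ltNge; apply/negP => Sn.
  have := ge_inf lS Sn; rewrite leNgt => /negP; apply.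
  by rewrite ltrBlDr ltrDl invr_gt0.
have mF n : measurable (F n) by exact: measurable_RV_le.
have ndF : nondecreasing_seq F.
  apply/nondecreasing_seqP => n; apply/subsetPset => x /= /le_trans; apply.
  by rewrite lerD2l lerN2 lef_pV2 ?posrE// ler_nat.
have : (P (\bigcup_n F n) <= (2^-1)%:E)%E.
  have cF := nondecreasing_cvg_mu (mu := P) mF (bigcupT_measurable _ mF) ndF.
  by apply: cvge_le cF; apply: filterE.
rewrite FE probability_setC; last exact: measurable_RV_ge.
have Pfin : P [set x | inf S <= f x] \is a fin_num.
  by rewrite fin_num_measure//; exact: measurable_RV_ge.
rewrite -(fineK Pfin) -EFinB !lee_fin; lra.
Unshelve. all: by end_near. Qed.

(* The bound c r^2 >= 2 sqrt(c) r - 1 replaces the Gaussian tail by an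
   exponential one. *)
Lemma subgaussian_expectation_le g (K c : R) : (forall x, 0 <= g x) ->
  0 < K -> 0 < c ->
  (forall r, 0 <= r ->
     (P [set x | (r <= g x)%R] <= (K * expR (- (c * r ^+ 2)))%:E)%E) ->
  ('E_P[g] <= (K * expR 1 / (2 * Num.sqrt c))%:E)%E.
Proof.
move=> g0 K0 c0 tail; rewrite ge0_expectation_ccdf//.
have sc0 : 0 < Num.sqrt c by rewrite sqrtr_gt0.
(* The tail is dominated by [a] times the density of the exponential law of this rate; that density
   has integral 1, so [a] bounds the expectation. *)
pose rate : R := 2 * Num.sqrt c.
have rate0 : 0 < rate by rewrite mulr_gt0.
pose a := K * expR 1 / rate.
have a0 : 0 <= a by rewrite !mulr_ge0 ?expR_ge0 ?invr_ge0 ?ltW.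
pose p : R -> R := exponential_pdf rate.
have p0 x : (0 <= (p x)%:E)%E.
  by rewrite lee_fin exponential_pdf_ge0 ?ltW.
have mp : measurable_fun setT (fun x => (p x)%:E).
  by apply/measurable_EFinP; exact: measurable_exponential_pdf.
apply: (@le_trans _ _ (\int[lebesgue_measure]_(r in `[0%R, +oo[)
    (a%:E * (p r)%:E)))%E.
  apply: ge0_le_integral => //=.
  - by apply: measurable_funTS; exact: ccdf_measurable.
  - by apply: measurable_funeM; exact: measurable_funTS.
  move=> r; rewrite in_itv/= andbT => r0.
  rewrite -EFinM /p exponential_pdfE//.
  apply: (@le_trans _ _ (P [set x | (r <= g x)%R])).
    rewrite /ccdf /distribution/= /pushforward le_measure ?inE//=.
    - rewrite -[X in measurable X]setTI; exact: measurable_funP.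
    - exact: measurable_RV_ge.
    - by move=> x/=; rewrite in_itv/= andbT => /ltW.
  apply: le_trans (tail _ r0) _; rewrite lee_fin.
  have -> : a * (rate * expR (- rate * r)) = K * expR (1 - rate * r).
    by rewrite /a expRD mulrA divfK ?gt_eqF// mulrA mulNr.
  rewrite ler_pM2l// ler_expR.
  have := sqr_ge0 (Num.sqrt c * r - 1).
  have : Num.sqrt c ^+ 2 = c by rewrite sqr_sqrtr ?ltW.
  rewrite /rate; set s := Num.sqrt c => sc; rewrite -[in X in _ -> X]sc; nra.
rewrite ge0_integralZl//; last exact: measurable_funTS.
rewrite -[leRHS]mule1 -(integral_exponential_pdf rate0).
rewrite lee_wpmul2l ?lee_fin//.
exact: ge0_subset_integral.
Qed.

(* With a the bound on E|f - M|: for r >= 2a the deviation from the mean is at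
   least r/2 from M, while for r < 2a the second entry of the max makes the
   right-hand side exceed 1. *)
Lemma subgaussian_mean_deviation f (M K c : R) : 1 <= K -> 0 < c ->
  (forall r, 0 <= r ->
    (P [set x | (r <= `|f x - M|)%R] <= (K * expR (- (c * r ^+ 2)))%:E)%E) ->
  forall r, 0 < r ->
    (P [set x | r%:E <= `|(f x)%:E - \int[P]_y (f y)%:E|] <=
     (Num.max K (expR ((K * expR 1 / 2) ^+ 2))
        * expR (- (c / 4 * r ^+ 2)))%:E)%E.
Proof.
move=> K1 c0 tail r r0.
have K0 : 0 < K by exact: lt_le_trans K1.
have sc0 : 0 < Num.sqrt c by rewrite sqrtr_gt0.
pose g := RV_dist f M.
have mf : measurable_fun setT (EFin \o f) by exact/measurable_EFinP.
have gE x : g x = `|f x - M| by [].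
have Eg : ('E_P[g] <= (K * expR 1 / (2 * Num.sqrt c))%:E)%E.
  by apply: subgaussian_expectation_le => // x; rewrite gE.
set a := K * expR 1 / (2 * Num.sqrt c) in Eg.
(* The bound on the mean of |f - M| is what makes [f] integrable, hence its mean finite. *)
have ifM : P.-integrable setT (fun x => (f x - M)%:E).
  apply/integrableP; split.
    by apply/measurable_EFinP; exact: measurable_funB.
  by move: Eg; rewrite expectation_def => /le_lt_trans; apply; rewrite ltry.
have iM : P.-integrable setT (fun=> M%:E).
  exact: finite_measure_integrable_cst.
have fE : (fun x => (f x)%:E) = (fun x => (f x - M)%:E + M%:E)%E.
  by apply/funext => x; rewrite -EFinD subrK.
have Ef : (\int[P]_y (f y)%:E = \int[P]_y (f y - M)%:E + M%:E)%E.
  rewrite fE integralD//; congr (_ + _)%E.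
  by rewrite integral_cst// -[RHS]mule1; congr (_ * _)%E; exact: probability_setT.
have ffin : (\int[P]_y (f y - M)%:E)%E \is a fin_num.
  exact: integrable_fin_num.
pose mu := fine (\int[P]_y (f y - M)%:E)%E.
have muE : (\int[P]_y (f y)%:E = (mu + M)%:E)%E.
  by rewrite Ef EFinD fineK.
have mua : `|mu| <= a.
  rewrite -lee_fin -abse_EFin fineK//.
  apply: le_trans (le_abse_integral _ _ _) _ => //; first exact: measurable_int ifM.
  by move: Eg; rewrite expectation_def.
(* The product is independent of [c], which is why the new constant depends on [K] alone. *)
have a2 : c * a ^+ 2 = (K * expR 1 / 2) ^+ 2.
  have : Num.sqrt c ^+ 2 = c by rewrite sqr_sqrtr ?ltW.
  by rewrite /a; set s := Num.sqrt c => sc; rewrite -[X in X * _]sc; field; rewrite gt_eqF.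
have -> : [set x | (r%:E <= `|(f x)%:E - \int[P]_y (f y)%:E|)%E] =
          [set x | r <= `|f x - (mu + M)|].
  by rewrite muE; apply/seteqP; split => x /=.
have mS : measurable [set x | r <= `|f x - (mu + M)|].
  exact: (measurable_RV_ge (RV_dist f (mu + M))).
have [ra|ra] := leP (2 * a) r.
  apply: (@le_trans _ _ (P [set x | (r / 2 <= `|f x - M|)%R])).
    rewrite le_measure ?inE//=.
      exact: (measurable_RV_ge g).
    move=> x /=; have := ler_normB (f x - M) mu.
    have -> : f x - M - mu = f x - (mu + M) by ring.
    lra.
  apply: le_trans (tail _ _) _; first lra.
  rewrite lee_fin ler_pM ?expR_ge0 ?(ltW K0) ?le_max ?lexx//.
  by rewrite ler_expR lerN2; nra.
apply: (@le_trans _ _ 1%E); first exact: probability_le1.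
rewrite lee_fin.
apply: (@le_trans _ _ (expR ((K * expR 1 / 2) ^+ 2) * expR (- (c / 4 * r ^+ 2)))).
  rewrite -expRD -[leLHS]expR0 ler_expR -a2.
  have r2 : r ^+ 2 <= 4 * a ^+ 2 by nra.
  have := ler_wpM2l (ltW c0) r2; lra.
by rewrite ler_pM2r ?expR_gt0// le_max lexx orbT.
Qed.
(** [g] is at most [r] times the indicator of the complement of [A], which has probability at most
    1/2. *)
Lemma mean_le_half g (A : set T) (r : R) : measurable A ->
  ((2^-1)%:E <= P A)%E -> (forall x, A x -> g x = 0) ->
  (forall x, 0 <= g x <= r) ->
  exists2 E, (\int[P]_x (g x)%:E = E%:E)%E & E <= r / 2.
Proof.
move=> mA hA gA g0r.
have g0 x : 0 <= g x by have /andP[] := g0r x.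
have gr x : g x <= r by have /andP[] := g0r x.
have r0 : 0 <= r by exact: le_trans (g0 point) (gr point).
have PA : P A \is a fin_num by rewrite fin_num_measure.
have mAC : measurable (~` A) by exact: measurableC.
have mg : measurable_fun setT (EFin \o g) by exact/measurable_EFinP.
have Eg : (\int[P]_x (g x)%:E <= (r / 2)%:E)%E.
  apply: (@le_trans _ _ (\int[P]_x (r%:E * (\1_(~` A) x)%:E))%E).
    apply: ge0_le_integral => // [x _||x _]; first by rewrite lee_fin.
    - by apply: measurable_funeM; apply/measurable_EFinP; exact: measurable_indic.
    rewrite -EFinM lee_fin indicE.
    have [/set_mem Ax|] := boolP (x \in A).
      by rewrite gA// mulr_ge0.
    by move=> xA; rewrite in_setC xA mulr1.
  rewrite ge0_integralZl//; last first.
    by apply/measurable_EFinP; exact: measurable_indic.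
  have -> : (\int[P]_x (\1_(~` A) x)%:E = (1 - fine (P A))%:E)%E.
    rewrite integral_indic// setIT EFinB fineK//; exact: probability_setC.
  rewrite -EFinM lee_fin ler_wpM2l//.
  by move: hA; rewrite -(fineK PA) lee_fin; lra.
have E0 : (0 <= \int[P]_x (g x)%:E)%E by apply: integral_ge0 => x _; rewrite lee_fin.
have Efin : (\int[P]_x (g x)%:E)%E \is a fin_num.
  by rewrite ge0_fin_numE// (le_lt_trans Eg) ?ltry.
by exists (fine (\int[P]_x (g x)%:E)%E); rewrite -?lee_fin fineK.
Qed.

(** Where [g] reaches [r] it exceeds its mean by at least [r / 2]. The sign [s] is carried along
    because one of the two distance functions is 1-Lipschitz only after negation. *)
Lemma deviation_bound_max g (A : set T) (r s : R) : measurable A ->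
  ((2^-1)%:E <= P A)%E -> (forall x, A x -> g x = 0) ->
  (forall x, 0 <= g x <= r) -> `|s| = 1 ->
  (P [set x | (r <= g x)%R] <=
   P [set x | ((r / 2)%:E <= `|(s * g x)%:E - \int[P]_y (s * g y)%:E|)])%E.
Proof.
move=> mA hA gA g0r s1.
have [E EE Er] := mean_le_half mA hA gA g0r.
have mg : measurable_fun setT (EFin \o g) by exact/measurable_EFinP.
have -> : (\int[P]_y (s * g y)%:E = (s * E)%:E)%E.
  under eq_integral do rewrite EFinM.
  rewrite integralZl//; first by rewrite EE -EFinM.
  apply/integrableP; split => //.
  rewrite [X in (X < _)%E](_ : _ = E%:E) ?ltry// -EE; apply: eq_integral => x _ /=.
  by rewrite ger0_norm//; have /andP[] := g0r x.
have -> : [set x | ((r / 2)%:E <= `|(s * g x)%:E - (s * E)%:E|)%E] =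
    [set x | r / 2 <= `|g x - E| ].
  by apply/seteqP; split => x /=; rewrite -mulrBr normrM s1 mul1r.
rewrite le_measure ?inE//=.
- exact: measurable_RV_ge.
- exact: (measurable_RV_ge (RV_dist g E)).
- by move=> x /= rg; have := ler_norm (g x - E); lra.
Qed.
End Probability.

Section UnitMass.
Context d (T : measurableType d) (R : realType) (m : {measure set T -> \bar R}).
Hypothesis m1 : m setT = 1%E.

(** A fresh name for [m], to which a probability structure can be attached; results on random
    variables then apply to it. *)
Let unit_mass : set T -> \bar R := m.
HB.instance Definition _ := Measure.copy unit_mass m.
HB.instance Definition _ := Measure_isProbability.Build _ _ _ unit_mass m1.

Definition unit_mass_probability : probability T R := unit_mass.

End UnitMass.

(** * Concentration and deviation *)

Section Metric.
Context (R : realType) (n : nat) (X : finslerMMM R n).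
Local Notation d := (finsler_dist (fm_metric X)).
Local Notation m := (fm_measure X).

(** The two one-sided bounds on f(x') - f(x) use d(x, x') and d(x', x), both of which are small near
    [x]. *)
Lemma lipschitz1_continuous (f : X -> R) : lipschitz1 f -> continuous f.
Proof.
move=> fL x; apply/cvgrPdist_lt => eps e0.
apply: filterS (finsler_dist_near (fm_metric X) x e0) => x' [h1 h2].
have := le_lt_trans (fL x x') h1; have := le_lt_trans (fL x' x) h2.
by rewrite !lte_fin ltr_norml; lra.
Qed.

(** By the triangle inequality, a point [x] at distance [s] < [r] from some [z] in [A] may be moved
    by less than [r - s]. *)
Lemma open_fball (A : set X) (r : R) : open (fball A r).
Proof.
rewrite openE => x /ereal_inf_lt[_ [z Az <-] zxr].
have [s /andP[zs sr]] : exists s : R, (d z x <= s%:E)%E && (s < r).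
  move: zxr (finsler_dist_ge0 (fm_metric X) z x); case: (d z x) => // s sr _.
  by exists s; rewrite lexx -lte_fin.
have rs : 0 < r - s by rewrite subr_gt0.
apply: filterS (finsler_dist_near (fm_metric X) x rs) => x' [xx' _].
apply: le_lt_trans (_ : d z x' < _)%E.
  by apply: ereal_inf_lbound; exists z.
apply: le_lt_trans (finsler_dist_triangle _ _ x _) _.
rewrite -[r](subrKC s) EFinD; apply: le_lt_trans (leeD2r _ zs) _.
by rewrite lteD2lE.
Qed.

Lemma open_bball (A : set X) (r : R) : open (bball A r).
Proof.
rewrite openE => x /ereal_inf_lt[_ [z Az <-] zxr].
have [s /andP[zs sr]] : exists s : R, (d x z <= s%:E)%E && (s < r).
  move: zxr (finsler_dist_ge0 (fm_metric X) x z); case: (d x z) => // s sr _.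
  by exists s; rewrite lexx -lte_fin.
have rs : 0 < r - s by rewrite subr_gt0.
apply: filterS (finsler_dist_near (fm_metric X) x rs) => x' [_ xx'].
apply: le_lt_trans (_ : d x' z < _)%E.
  by apply: ereal_inf_lbound; exists z.
apply: le_lt_trans (finsler_dist_triangle _ _ x _) _.
rewrite -[r](subrK s) EFinD; apply: le_lt_trans (leeD2l _ zs) _.
by rewrite lteD2rE.
Qed.

Lemma open_borel (A : set X) : open A -> measurable (A : set (borel X)).
Proof. exact: sub_sigma_algebra. Qed.

Lemma lipschitz1_measurable (f : X -> R) : lipschitz1 f ->
  measurable_fun [set: borel X] (f : borel X -> R).
Proof.
move=> /lipschitz1_continuous/continuousP cf.
apply: (measurability _ (RGenOpens.measurableE R)) => _ [_ [a [b ->] <-]].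
rewrite setTI; apply: open_borel; apply: cf; exact: interval_open.
Qed.

(** Capping at [r] makes a nonnegative extended-real distance a real function, also where it is
    infinite, as for the empty set. *)
Definition truncate (r : R) (D : X -> \bar R) (x : X) : R :=
  fine (Order.min (D x) r%:E).

Lemma EFin_truncate (r : R) (D : X -> \bar R) (x : X) : (0 <= D x)%E ->
  (truncate r D x)%:E = Order.min (D x) r%:E.
Proof.
rewrite /truncate; case: (D x) => [s _| _|//].
  by rewrite -EFin_min.
by rewrite (min_idPr _) ?leey.
Qed.

Lemma truncateD (r : R) (D : X -> \bar R) (x z : X) (e : \bar R) :
  (forall y, 0 <= D y)%E -> (0 <= e)%E -> (D z <= D x + e)%E ->
  ((truncate r D z - truncate r D x)%:E <= e)%E.
Proof.
move=> D0 e0 Dzx; rewrite EFinB leeBlDr// !EFin_truncate//.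
have [Dx|Dx] := leP (D x) r%:E.
  by rewrite ge_min addeC Dzx.
by rewrite ge_min leeDr ?orbT.
Qed.

Definition dist_from (A : set X) (x : X) : \bar R :=
  ereal_inf [set d z x | z in A].
Definition dist_to (A : set X) (x : X) : \bar R :=
  ereal_inf [set d x z | z in A].

Lemma dist_from_ge0 (A : set X) (x : X) : (0 <= dist_from A x)%E.
Proof. by apply: le_ereal_inf_tmp => _ [w _ <-]; exact: finsler_dist_ge0. Qed.

Lemma dist_to_ge0 (A : set X) (x : X) : (0 <= dist_to A x)%E.
Proof. by apply: le_ereal_inf_tmp => _ [w _ <-]; exact: finsler_dist_ge0. Qed.

Lemma lipschitz1_dist_from (A : set X) (r : R) :
  lipschitz1 (truncate r (dist_from A)).
Proof.
move=> x z; have d0 := finsler_dist_ge0 (fm_metric X) x z.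
apply: truncateD => //; first exact: dist_from_ge0.
have [dfin|] := boolP (d x z \is a fin_num); last first.
  rewrite ge0_fin_numE// -leNgt leye_eq => /eqP ->.
  by rewrite addey ?leey// gt_eqF// (lt_le_trans _ (dist_from_ge0 A x)).
rewrite -leeBlDr//; apply: le_ereal_inf_tmp => _ [w Aw <-].
rewrite leeBlDr//; apply: le_trans (finsler_dist_triangle _ _ x _).
by apply: ereal_inf_lbound; exists w.
Qed.

(** The triangle inequality d(x, w) <= d(x, z) + d(z, w) controls the value at [x] minus the value
    at [z], hence the minus sign. *)
Lemma lipschitz1_dist_to (A : set X) (r : R) :
  lipschitz1 (fun x => - truncate r (dist_to A) x).
Proof.
move=> x z; have d0 := finsler_dist_ge0 (fm_metric X) x z.
rewrite opprK addrC.
apply: truncateD => //; first exact: dist_to_ge0.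
have [dfin|] := boolP (d x z \is a fin_num); last first.
  rewrite ge0_fin_numE// -leNgt leye_eq => /eqP ->.
  by rewrite addey ?leey// gt_eqF// (lt_le_trans _ (dist_to_ge0 A z)).
rewrite -leeBlDr//; apply: le_ereal_inf_tmp => _ [w Aw <-].
rewrite leeBlDr// addeC; apply: le_trans (finsler_dist_triangle _ _ z _).
by apply: ereal_inf_lbound; exists w.
Qed.

Hypothesis mX1 : m setT = 1%E.

Lemma truncate_bound (r : R) (D : X -> \bar R) (x : X) : 0 <= r ->
  (0 <= D x)%E -> 0 <= truncate r D x <= r.
Proof.
move=> r0 D0; rewrite -!lee_fin EFin_truncate//.
by rewrite le_min D0 lee_fin r0 ge_min lexx orbT.
Qed.

Lemma truncate_ge (r : R) (D : X -> \bar R) (x : X) : (0 <= D x)%E ->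
  (r <= truncate r D x) = (r%:E <= D x)%E.
Proof. by move=> D0; rewrite -lee_fin EFin_truncate// le_min lexx andbT. Qed.

(* f = s * min(D, r) vanishes on A, so its mean is within r/2 of 0, whereas
   |f| = r off the enlargement. *)
Lemma enlargement_compl_le (K k r s : R) (A : set (borel X)) (D : X -> \bar R) :
  lipschitz_deviation_bound X K k -> 0 < r -> `|s| = 1 ->
  measurable A -> ((2^-1)%:E <= m A)%E ->
  (forall x, 0 <= D x)%E -> (forall x, A x -> D x = 0%E) ->
  lipschitz1 (fun x => s * truncate r D x) ->
  (1 - m [set x | (D x < r%:E)%E] <= (K * expR (- (k / 4 * r ^+ 2)))%:E)%E.
Proof.
move=> dev r0 s1 mA hA D0 DA fL.
pose P := unit_mass_probability mX1.
pose g0 : borel X -> R := truncate r D.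
have mg : measurable_fun setT g0.
  (* Measurability is known for the 1-Lipschitz function [s * truncate r D]; multiplying by [s]
     again recovers [g0], as the square of [s] is 1. *)
  have -> : g0 = (fun x => s * (s * truncate r D x)).
    by apply/funext => x; rewrite mulrA -expr2 -(real_normK (num_real s)) s1 expr1n mul1r.
  by apply: measurable_funM => //; exact: lipschitz1_measurable fL.
pose g : {RV P >-> R} := HB.pack g0 (isMeasurableFun.Build _ _ _ _ _ mg).
have gA x : A x -> g x = 0.
  by move=> Ax; rewrite /g/= /g0 /truncate DA// (min_idPl _)// lee_fin ltW.
have g0r x : 0 <= g x <= r by apply: truncate_bound => //; exact: ltW.
have -> : [set x | (D x < r%:E)%E] = ~` [set x | r <= truncate r D x].
  by apply/seteqP; split => x /=; rewrite truncate_ge// ltNge => /negP.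
have mS : measurable [set x | r <= g x] by exact: measurable_RV_ge.
have -> : (1 - m (~` [set x | (r <= truncate r D x)%R]) = P [set x | (r <= g x)%R])%E.
  have -> : m (~` [set x | r <= truncate r D x]) = (1 - P [set x | (r <= g x)%R])%E.
    exact: (probability_setC P).
  have Pfin : P [set x | (r <= g x)%R] \is a fin_num by rewrite fin_num_measure.
  by move: Pfin; case: (P _) => //= p _; congr EFin; ring.
apply: le_trans (deviation_bound_max mA hA gA g0r s1) _.
(* Deviation is used at [r / 2]; this is the source of the factor 1/4 in the exponent. *)
apply: le_trans (dev _ fL _ (_ : 0 < r / 2)) _; first by rewrite divr_gt0.
by rewrite lee_fin (_ : k * (r / 2) ^+ 2 = k / 4 * r ^+ 2)//; field.
Qed.

(** Whichever enlargement attains the minimum, its distance function is used: the distance from [A]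
    with sign 1, or the distance to [A] with sign -1. *)
Lemma concentration_of_deviation (K k : R) :
  lipschitz_deviation_bound X K k -> concentration_bound X K (k / 4).
Proof.
move=> dev r r0; apply: ge_ereal_sup => _ [A [mA hA] <-].
have [_|_] := leP (m (fball A r)) (m (bball A r)).
  apply: (enlargement_compl_le (A := A) (s := 1) (D := dist_from A) dev r0) => //.
  - by rewrite normr1.
  - exact: dist_from_ge0.
  - move=> x Ax; apply/eqP; rewrite eq_le dist_from_ge0 andbT.
    by apply: ereal_inf_lbound; exists x => //; exact: finsler_dist_refl.
  - by under eq_fun do rewrite mul1r; exact: lipschitz1_dist_from.
apply: (enlargement_compl_le (A := A) (s := -1) (D := dist_to A) dev r0) => //.
- by rewrite normrN1.
- exact: dist_to_ge0.
- move=> x Ax; apply/eqP; rewrite eq_le dist_to_ge0 andbT.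
  by apply: ereal_inf_lbound; exists x => //; exact: finsler_dist_refl.
- by under eq_fun do rewrite mulN1r; exact: lipschitz1_dist_to.
Qed.

(** The two one-sided tails around a median contribute [2 * C]; the added 1 covers r = 0 and gives
    the condition K >= 1 of [subgaussian_mean_deviation]. The maximum and the factor 1/4 come from
    replacing the median by the mean. *)
Lemma deviation_of_concentration (C c : R) : 0 < C -> 0 < c ->
  concentration_bound X C c ->
  lipschitz_deviation_bound X
    (Num.max (1 + 2 * C) (expR (((1 + 2 * C) * expR 1 / 2) ^+ 2))) (c / 4).
Proof.
move=> C0 c0 conc f fL.
pose P := unit_mass_probability mX1.
have mf := lipschitz1_measurable fL.
pose g : {RV P >-> R} := HB.pack (f : borel X -> R) (isMeasurableFun.Build _ _ _ _ _ mf).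
have [M [leM geM]] := median_exists g.
have mle := measurable_RV_le g; have mge := measurable_RV_ge g.
(* An event disjoint from an enlargement is bounded by the measure of its complement. *)
have compl (B : set (borel X)) (S : set (borel X)) b : open (B : set X) -> measurable S ->
    (1 - m B <= b)%E -> S `&` B = set0 -> (P S <= b)%E.
  move=> oB mS Bb SB0; apply: le_trans Bb.
  have mB := open_borel oB.
  have <- : P (~` B) = (1 - m B)%E by exact: (probability_setC P).
  apply: le_measure; rewrite ?inE//; first exact: measurableC.
  by apply/subsets_disjoint; rewrite setCK.
have supconc (A : set (borel X)) r : 0 < r -> measurable A -> ((2^-1)%:E <= m A)%E ->
    (1 - Order.min (m (fball A r)) (m (bball A r)) <=
       (C * expR (- (c * r ^+ 2)))%:E)%E.
  by move=> r0 mA hA; apply: le_trans (conc r r0); apply: ereal_sup_ubound; exists A.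
(* If f(z) <= M and d(z, x) < r, then f(x) < M + r: the event misses the forward enlargement. *)
have tail_ge r : 0 < r ->
    (P [set x | (M + r <= g x)%R] <= (C * expR (- (c * r ^+ 2)))%:E)%E.
  move=> r0; apply: (compl (fball [set x | g x <= M] r)) => //.
  - exact: open_fball.
  - apply: le_trans (supconc _ r r0 (mle M) leM).
    by rewrite leeB// ge_min lexx.
  apply/seteqP; split => // x [/= Mx /ereal_inf_lt[_ [z zM <-]]].
  move=> /(le_lt_trans (fL z x)); rewrite lte_fin.
  have : f z <= M by []. have : M + r <= f x by []. lra.
(* If M <= f(z) and d(x, z) < r, then f(x) > M - r, so here the backward enlargement is the right
   one. *)
have tail_le r : 0 < r ->
    (P [set x | (g x <= M - r)%R] <= (C * expR (- (c * r ^+ 2)))%:E)%E.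
  move=> r0; apply: (compl (bball [set x | M <= g x] r)) => //.
  - exact: open_bball.
  - apply: le_trans (supconc _ r r0 (mge M) geM).
    by rewrite leeB// ge_min lexx orbT.
  apply/seteqP; split => // x [/= Mx /ereal_inf_lt[_ [z zM <-]]].
  move=> /(le_lt_trans (fL x z)); rewrite lte_fin.
  have : M <= f z by []. have : f x <= M - r by []. lra.
apply: (@subgaussian_mean_deviation _ _ _ P g M) => //; first lra.
move=> r; rewrite le_eqVlt => /predU1P[<-|r0].
  rewrite (_ : [set x | _] = setT); last by apply/seteqP; split => x /=.
  apply: (@le_trans _ _ 1%E); first exact: probability_le1.
  by rewrite expr0n/= mulr0 oppr0 expR0 lee_fin; lra.
rewrite (_ : [set x | _] = [set x | M + r <= g x] `|` [set x | g x <= M - r]).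
  2: apply/seteqP; split => x /=; rewrite ler_normr.
  2: by move=> /orP[?|?]; [left|right]; lra.
  2: by move=> [?|?]; apply/orP; [left|right]; lra.
apply: (le_trans (measureU2 P (mge _) (mle _))).
apply: le_trans (leeD (tail_ge r r0) (tail_le r r0)) _.
rewrite -EFinD lee_fin; have := expR_gt0 (- (c * r ^+ 2)); nra.
Qed.

End Metric.

(** The functions [C'] and [c'] are chosen before the dimension and the manifold, which expresses
    that the constants depend on [C] and on [c] only. *)
Theorem theorem3p12 (R : realType) :
  exists C' c' : R -> R,
    [/\ (forall C : R, 0 < C -> 0 < C' C),
        (forall c : R, 0 < c -> 0 < c' c) &
        forall (n : nat) (X : finslerMMM R n),
          fm_measure X [set: X] = 1%E ->
          (normal_concentration X <->
           exists K k : R, [/\ 0 < K, 0 < k & lipschitz_deviation_bound X K k])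
          /\
          (forall C c : R, 0 < C -> 0 < c ->
             concentration_bound X C c ->
             lipschitz_deviation_bound X (C' C) (c' c))].
Proof.
pose C' (C : R) := Num.max (1 + 2 * C) (expR (((1 + 2 * C) * expR 1 / 2) ^+ 2)).
have C'0 C : 0 < C -> 0 < C' C by rewrite /C' lt_max expR_gt0 orbT.
exists C', (fun c => c / 4); split => // [c c0|n X mX1]; first by rewrite divr_gt0.
have dev C c : 0 < C -> 0 < c -> concentration_bound X C c ->
    lipschitz_deviation_bound X (C' C) (c / 4).
  exact: deviation_of_concentration.
split=> //; split.
  move=> [C [c [C0 c0 conc]]]; exists (C' C), (c / 4).
  by split; [exact: C'0|rewrite divr_gt0|exact: dev].
move=> [K [k [K0 k0 devK]]]; exists K, (k / 4).
by split; [|rewrite divr_gt0|exact: concentration_of_deviation].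
Qed.
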